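(* For every rational $k\in[2,3)$ we have $$g(k,4)=\tfrac12\Bigl(\sqrt{(k-1)^2+4}-k+1\Bigr).$$
   Context: A fractional $m$-coloring of a graph $G$ (for a real $m>0$) is an assignment of a measurable subset of $[0,m)\subseteq\mathbb R$ of Lebesgue measure one to each vertex such that adjacent vertices receive disjoint sets. $G$ is fractionally $k$-colorable if it has a fractional $k$-coloring, i.e. its fractional chromatic number is at most $k$. A fractional $m$-precoloring of a vertex set $W$ is an assignment of measurable subsets of $[0,m)$ of measure one to the vertices of $W$; it extends to $G$ if there is a fractional $m$-coloring of $G$ agreeing with it on $W$. For a rational $k\ge 2$ and an integer $d\ge 3$, $g(k,d)$ is the infimum of the set of non-negative reals $\varepsilon$ such that for every $\varepsilon'\ge\varepsilon$, every fractionally $k$-colorable (finite) graph $G$ and every set $W\subseteq V(G)$ of vertices at pairwise distance at least $d$, every fractional $(k+\varepsilon')$-precoloring of $W$ extends to a fractional $(k+\varepsilon')$-coloring of $G$. *)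

(* Defs.v *)
From Stdlib Require Export Reals QArith Qreals.
Open Scope R_scope.

(** [outer_le A r]: the Lebesgue outer measure of [A] is at most [r], i.e.
    for every eps > 0, [A] is covered by countably many open intervals
    (a i, b i) of total length at most r + eps. *)
Definition outer_le (A : R -> Prop) (r : R) : Prop :=
  forall eps : R, 0 < eps ->
    exists a b : nat -> R,
      (forall i, a i <= b i) /\
      (forall x, A x -> exists i, a i < x < b i) /\
      (forall N, sum_f_R0 (fun i => b i - a i) N <= r + eps).

Definition outer_measure_eq (A : R -> Prop) (r : R) : Prop :=
  outer_le A r /\ forall r', r' < r -> ~ outer_le A r'.

(** Caratheodory measurability: for every test set E,
    m*(E) >= m*(E /\ A) + m*(E \ A). *)
Definition lmeasurable (A : R -> Prop) : Prop :=
  forall (E : R -> Prop) (r : R), outer_le E r ->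
    exists r1 r2,
      outer_le (fun x => E x /\ A x) r1 /\
      outer_le (fun x => E x /\ ~ A x) r2 /\ r1 + r2 <= r.

Definition unit_color_set (m : R) (S : R -> Prop) : Prop :=
  (forall x, S x -> 0 <= x < m) /\ lmeasurable S /\ outer_measure_eq S 1.

Record graph := Graph {
  nv : nat;
  adj : nat -> nat -> Prop;
  adj_sym : forall u v, adj u v -> adj v u;
  adj_irrefl : forall u, ~ adj u u;
  adj_range : forall u v, adj u v -> (u < nv)%nat /\ (v < nv)%nat
}.

Inductive walk (G : graph) : nat -> nat -> nat -> Prop :=
| walk0 : forall u, walk G u u 0
| walkS : forall u w v l, adj G u w -> walk G w v l -> walk G u v (S l).

Definition dist_ge (G : graph) (u v : nat) (d : nat) : Prop :=
  forall l, walk G u v l -> (d <= l)%nat.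

Definition frac_coloring (G : graph) (m : R) (c : nat -> R -> Prop) : Prop :=
  (forall v, (v < nv G)%nat -> unit_color_set m (c v)) /\
  (forall u v, adj G u v -> forall x, ~ (c u x /\ c v x)).

Definition frac_colorable (G : graph) (k : R) : Prop :=
  exists c, frac_coloring G k c.

Definition far_apart (G : graph) (W : nat -> Prop) (d : nat) : Prop :=
  (forall w, W w -> (w < nv G)%nat) /\
  (forall u v, W u -> W v -> u <> v -> dist_ge G u v d).

Definition frac_precoloring (m : R) (W : nat -> Prop) (p : nat -> R -> Prop) : Prop :=
  forall w, W w -> unit_color_set m (p w).

Definition extends (G : graph) (m : R) (W : nat -> Prop) (p : nat -> R -> Prop) : Prop :=
  exists c, frac_coloring G m c /\ (forall w, W w -> forall x, c w x <-> p w x).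

Definition good_eps (k : R) (d : nat) (eps : R) : Prop :=
  0 <= eps /\
  forall eps', eps <= eps' ->
    forall (G : graph) (W : nat -> Prop) (p : nat -> R -> Prop),
      frac_colorable G k -> far_apart G W d ->
      frac_precoloring (k + eps') W p -> extends G (k + eps') W p.

Definition is_glb (P : R -> Prop) (x : R) : Prop :=
  (forall y, P y -> x <= y) /\ (forall b, (forall y, P y -> b <= y) -> b <= x).

Definition g_is (k : R) (d : nat) (x : R) : Prop := is_glb (good_eps k d) x.

(* Main.v *)
Require Import Defs.
From Stdlib Require Import Reals QArith Qreals.
From Stdlib Require Import Arith ZArith Lra Lia List Classical ClassicalEpsilon
  FunctionalExtensionality PropExtensionality.
Open Scope R_scope.

(** Write [K = k + e]; the claimed value is the positive root of [e (e + k - 1) = 1].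

    Upper bound.  By the intermediate value property of Lebesgue measure a [k]-coloring can be copied
    into [[0, K)] so that every color class meets every precolor [p w] in the proportion [1 / K] of
    its measure, and so does the unused set [O], of measure [e].  Vertices far from [W] keep this
    coloring.  A neighbour [v] of [w] in [W] takes its colors from the class of [v] and [O], minus
    [p w], a set of measure [(1 + e) (1 - 1 / K)], which is at least [1] iff [e (e + k - 1) >= 1].
    These choices do not conflict: [k < 3] excludes triangles, and the distance at least [4]
    excludes edges between neighbours of different vertices of [W].

    Lower bound.  For [k = n / m] and [K = N / m], take the circular graph on [Z/n] (adjacency at
    cyclic distance at least [m]), give every vertex [t] twins with pendant neighbours, and precolor
    those with all cyclic arcs of [m] cells among the [N] cells of [[0, K)].  Let [A t] be the set of
    colors absent from the neighbours of [t].  Averaging over the arcs, an extension forces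
    [|A t| (1 - 1 / K) >= 1].  A color used on an independent set [I] lies in [A t] unless [t] is in
    the neighbourhood of [I], which has at least [(k - 1) |I|] elements; hence the average of [|A t|]
    is at most [K - (k - 1) = 1 + e], so that [(1 + e) (1 - 1 / K) >= 1]. *)

(** * Caratheodory measurable sets *)

Definition cap (A B : R -> Prop) (x : R) : Prop := A x /\ B x.
Definition cup (A B : R -> Prop) (x : R) : Prop := A x \/ B x.
Definition dif (A B : R -> Prop) (x : R) : Prop := A x /\ ~ B x.
Definition subset (A B : R -> Prop) : Prop := forall x, A x -> B x.
Definition Ico (a b x : R) : Prop := a <= x < b.

Definition finite_outer (A : R -> Prop) : Prop := exists r, outer_le A r.

Lemma sum_f_R0_nonneg (f : nat -> R) (N : nat) :
  (forall i, 0 <= f i) -> 0 <= sum_f_R0 f N.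
Proof.
  intros Hf; induction N as [|N IH]; simpl; [apply Hf|].
  specialize (Hf (S N)); lra.
Qed.

Lemma sum_f_R0_mono (f : nat -> R) (N M : nat) :
  (forall i, 0 <= f i) -> (N <= M)%nat -> sum_f_R0 f N <= sum_f_R0 f M.
Proof.
  intros Hf HNM; induction HNM as [|M HNM IH]; simpl; [lra|].
  specialize (Hf (S M)); lra.
Qed.

Lemma sum_f_R0_term (f : nat -> R) (i N : nat) :
  (forall i, 0 <= f i) -> (i <= N)%nat -> f i <= sum_f_R0 f N.
Proof.
  intros Hf HiN; apply Rle_trans with (sum_f_R0 f i).
  - destruct i as [|i]; simpl; [lra|].
    pose proof (sum_f_R0_nonneg f i Hf); lra.
  - now apply sum_f_R0_mono.
Qed.

Lemma outer_le_subset (A B : R -> Prop) (r : R) :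
  subset A B -> outer_le B r -> outer_le A r.
Proof.
  intros HAB HB eps Heps; destruct (HB eps Heps) as (a & b & Hab & Hc & Hs).
  exists a, b; split; [exact Hab|split; [|exact Hs]].
  intros x Hx; apply Hc, HAB, Hx.
Qed.

Lemma outer_le_nonneg (A : R -> Prop) (r : R) : outer_le A r -> 0 <= r.
Proof.
  intros H; apply Rnot_lt_le; intros Hr.
  destruct (H (- r / 2) ltac:(lra)) as (a & b & Hab & _ & Hs).
  specialize (Hs 0%nat); simpl in Hs; specialize (Hab 0%nat); lra.
Qed.

Lemma outer_le_weaken (A : R -> Prop) (r s : R) : outer_le A r -> r <= s -> outer_le A s.
Proof.
  intros H Hrs eps Heps; destruct (H eps Heps) as (a & b & Hab & Hc & Hs).
  exists a, b; split; [exact Hab|split; [exact Hc|]].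
  intros N; specialize (Hs N); lra.
Qed.

Definition interleave (f g : nat -> R) (i : nat) : R :=
  if Nat.even i then f (Nat.div2 i) else g (Nat.div2 i).

Lemma interleave_even (f g : nat -> R) (i : nat) : interleave f g (2 * i) = f i.
Proof. unfold interleave; now rewrite Nat.even_even, Nat.div2_double. Qed.

Lemma interleave_odd (f g : nat -> R) (i : nat) : interleave f g (S (2 * i)) = g i.
Proof.
  unfold interleave; rewrite Nat.div2_succ_double.
  replace (S (2 * i)) with (2 * i + 1)%nat by lia.
  now rewrite Nat.even_odd.
Qed.

Lemma sum_interleave (a b a' b' : nat -> R) (N : nat) :
  sum_f_R0 (fun i => interleave b b' i - interleave a a' i) (S (2 * N)) =
  sum_f_R0 (fun i => b i - a i) N + sum_f_R0 (fun i => b' i - a' i) N.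
Proof.
  induction N as [|N IH]; [simpl; unfold interleave; simpl; lra|].
  replace (S (2 * S N)) with (S (S (S (2 * N)))) by lia.
  rewrite (tech5 _ (S (S (2 * N)))), (tech5 _ (S (2 * N))), IH; cbv beta.
  replace (S (S (2 * N))) with (2 * S N)%nat by lia.
  rewrite !interleave_even, !interleave_odd; simpl sum_f_R0; lra.
Qed.

(** Two covers, each with half of the slack [eps], are merged by alternating their intervals. *)
Lemma outer_le_cup (A B : R -> Prop) (r s : R) :
  outer_le A r -> outer_le B s -> outer_le (cup A B) (r + s).
Proof.
  intros HA HB eps Heps.
  destruct (HA (eps / 2) ltac:(lra)) as (a & b & Hab & Hc & Hs).
  destruct (HB (eps / 2) ltac:(lra)) as (a' & b' & Hab' & Hc' & Hs').
  exists (interleave a a'), (interleave b b').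
  assert (Hle : forall i, interleave a a' i <= interleave b b' i)
    by (intros i; unfold interleave; destruct (Nat.even i); auto).
  split; [exact Hle|split].
  - intros x [Hx|Hx].
    + destruct (Hc x Hx) as [i Hi]; exists (2 * i)%nat; now rewrite !interleave_even.
    + destruct (Hc' x Hx) as [i Hi]; exists (S (2 * i)); now rewrite !interleave_odd.
  (* Lengths are nonnegative, so it suffices to bound the partial sums with index [S (2 * N)], which
     contain equally many terms of both covers. *)
  - intros N; eapply Rle_trans.
    + apply (sum_f_R0_mono _ N (S (2 * N))); [|lia].
      intros i; specialize (Hle i); lra.
    + rewrite sum_interleave; specialize (Hs N); specialize (Hs' N); lra.
Qed.

Lemma outer_le_interval (a b : R) :
  a <= b -> outer_le (fun x => a <= x <= b) (b - a).
Proof.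
  intros Hab eps Heps.
  exists (fun i => match i with O => a - eps / 2 | _ => 0 end),
         (fun i => match i with O => b + eps / 2 | _ => 0 end).
  split; [intros [|i]; lra|split].
  - intros x Hx; exists O; lra.
  - intros N; assert (H : forall N, sum_f_R0 (fun i : nat =>
      match i with O => b + eps / 2 | _ => 0 end -
      match i with O => a - eps / 2 | _ => 0 end) N = b - a + eps).
    { induction N0 as [|N0 IH]; simpl; [lra|rewrite IH; lra]. }
    rewrite H; lra.
Qed.

(** The measure is the supremum of the lower bounds of the admissible [r]. It is admissible itself
    because [outer_le] leaves an arbitrary [eps] of room. *)
Lemma finite_outer_measure (A : R -> Prop) :
  finite_outer A -> exists r, outer_measure_eq A r.
Proof.
  intros [r0 Hr0].
  destruct (completeness (fun t => forall r, outer_le A r -> t <= r)) as [s [Hub Hlub]].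
  - exists r0; intros t Ht; apply Ht, Hr0.
  - exists 0; intros r Hr; now apply outer_le_nonneg in Hr.
  - exists s; split.
    + intros eps Heps.
      destruct (classic (exists r, outer_le A r /\ r < s + eps / 2)) as [[r [Hr Hlt]]|Hno].
      * destruct (Hr (eps / 2) ltac:(lra)) as (a & b & Hab & Hc & Hs).
        exists a, b; split; [exact Hab|split; [exact Hc|]].
        intros N; specialize (Hs N); lra.
      * exfalso; assert (s + eps / 2 <= s); [|lra].
        apply Hub; intros r Hr; apply Rnot_lt_le; intros Hlt; apply Hno; eauto.
    + intros r' Hr' Hle; assert (s <= r'); [|lra].
      apply Hlub; intros t Ht; now apply Ht.
Qed.

(** Equal to [0] on sets of infinite outer measure. *)
Definition mu (A : R -> Prop) : R :=
  match excluded_middle_informative (exists r, outer_measure_eq A r) with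
  | left H => proj1_sig (constructive_indefinite_description _ H)
  | right _ => 0
  end.

Lemma mu_spec (A : R -> Prop) : finite_outer A -> outer_measure_eq A (mu A).
Proof.
  intros H; unfold mu.
  destruct (excluded_middle_informative _) as [H'|H'].
  - apply (proj2_sig (constructive_indefinite_description _ H')).
  - exfalso; apply H', finite_outer_measure, H.
Qed.

Lemma mu_outer_le (A : R -> Prop) : finite_outer A -> outer_le A (mu A).
Proof. intros H; apply (mu_spec A H). Qed.

Lemma mu_le (A : R -> Prop) (r : R) : outer_le A r -> mu A <= r.
Proof.
  intros H; apply Rnot_lt_le; intros Hr.
  exact (proj2 (mu_spec A (ex_intro _ r H)) r Hr H).
Qed.

Lemma mu_unique (A : R -> Prop) (r : R) : outer_measure_eq A r -> mu A = r.
Proof.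
  intros [H1 H2]; apply Rle_antisym; [now apply mu_le|].
  apply Rnot_lt_le; intros Hr; apply (H2 _ Hr), mu_outer_le; now exists r.
Qed.

Lemma mu_nonneg (A : R -> Prop) : 0 <= mu A.
Proof.
  unfold mu; destruct (excluded_middle_informative _) as [H|H]; [|lra].
  destruct (constructive_indefinite_description _ H) as [r [Hr Hr']]; simpl.
  now apply outer_le_nonneg in Hr.
Qed.

Lemma finite_subset (A B : R -> Prop) : subset A B -> finite_outer B -> finite_outer A.
Proof. intros H [r Hr]; exists r; now apply outer_le_subset with B. Qed.

Lemma finite_cup (A B : R -> Prop) : finite_outer A -> finite_outer B -> finite_outer (cup A B).
Proof. intros [r Hr] [s Hs]; exists (r + s); now apply outer_le_cup. Qed.

Lemma finite_cap (A B : R -> Prop) : finite_outer A -> finite_outer (cap A B).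
Proof. apply finite_subset; now intros x []. Qed.

Lemma finite_dif (A B : R -> Prop) : finite_outer A -> finite_outer (dif A B).
Proof. apply finite_subset; now intros x []. Qed.

Lemma mu_mono (A B : R -> Prop) : subset A B -> finite_outer B -> mu A <= mu B.
Proof.
  intros H HB; apply mu_le, outer_le_subset with B; [exact H|now apply mu_outer_le].
Qed.

Lemma mu_ext (A B : R -> Prop) :
  (forall x, A x <-> B x) -> mu A = mu B.
Proof.
  intros H; f_equal; apply functional_extensionality.
  intros x; apply propositional_extensionality, H.
Qed.

Lemma mu_empty (A : R -> Prop) : (forall x, ~ A x) -> mu A = 0.
Proof.
  intros H; apply Rle_antisym; [|apply mu_nonneg].
  apply mu_le, outer_le_subset with (fun x => 0 <= x <= 0).
  - intros x Hx; now apply H in Hx.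
  - apply outer_le_weaken with (0 - 0); [apply outer_le_interval|]; lra.
Qed.

Lemma mu_cup_le (A B : R -> Prop) :
  finite_outer A -> finite_outer B -> mu (cup A B) <= mu A + mu B.
Proof. intros HA HB; apply mu_le, outer_le_cup; now apply mu_outer_le. Qed.

Lemma mu_split (X A : R -> Prop) :
  lmeasurable X -> finite_outer A -> mu A = mu (cap A X) + mu (dif A X).
Proof.
  intros HX HA; apply Rle_antisym.
  - eapply Rle_trans; [|apply mu_cup_le; [now apply finite_cap|now apply finite_dif]].
    apply mu_mono; [|apply finite_cup; [now apply finite_cap|now apply finite_dif]].
    intros x Hx; destruct (classic (X x)); [left|right]; now split.
  - destruct (HX A (mu A) (mu_outer_le A HA)) as (r1 & r2 & H1 & H2 & H).
    apply mu_le in H1, H2; unfold cap, dif; lra.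
Qed.

Lemma lmeasurable_intro (X : R -> Prop) :
  (forall E, finite_outer E -> mu (cap E X) + mu (dif E X) <= mu E) -> lmeasurable X.
Proof.
  intros H E r Hr; assert (HE : finite_outer E) by now exists r.
  exists (mu (cap E X)), (mu (dif E X)); split; [|split].
  - now apply mu_outer_le, finite_cap.
  - now apply mu_outer_le, finite_dif.
  - specialize (H E HE); apply mu_le in Hr; lra.
Qed.

Lemma lmeasurable_ext (X Y : R -> Prop) :
  (forall x, X x <-> Y x) -> lmeasurable X -> lmeasurable Y.
Proof.
  intros H HX; apply lmeasurable_intro; intros E HE; rewrite (mu_split X E HX HE).
  apply Req_le; f_equal; apply mu_ext; intros x; unfold cap, dif; specialize (H x); tauto.
Qed.

Lemma lmeasurable_compl (X : R -> Prop) :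
  lmeasurable X -> lmeasurable (fun x => ~ X x).
Proof.
  intros HX; apply lmeasurable_intro; intros E HE; rewrite (mu_split X E HX HE).
  rewrite Rplus_comm; apply Req_le; f_equal; apply mu_ext; intros x; unfold cap, dif; tauto.
Qed.

(** Cutting [E] by [X] and then [cap E X] by [Y] gives three pieces; two of them are the pieces into
    which [X] cuts [dif E (cap X Y)]. *)
Lemma lmeasurable_cap (X Y : R -> Prop) :
  lmeasurable X -> lmeasurable Y -> lmeasurable (cap X Y).
Proof.
  intros HX HY; apply lmeasurable_intro; intros E HE.
  rewrite (mu_split X E HX HE), (mu_split Y (cap E X) HY) by now apply finite_cap.
  rewrite (mu_split X (dif E (cap X Y)) HX) by now apply finite_dif.
  rewrite Rplus_assoc; apply Req_le; f_equal; [|f_equal];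
    apply mu_ext; intros x; unfold cap, dif; tauto.
Qed.

Lemma lmeasurable_dif (X Y : R -> Prop) :
  lmeasurable X -> lmeasurable Y -> lmeasurable (dif X Y).
Proof.
  intros HX HY; apply (lmeasurable_cap X (fun x => ~ Y x)); auto using lmeasurable_compl.
Qed.

Lemma lmeasurable_cup (X Y : R -> Prop) :
  lmeasurable X -> lmeasurable Y -> lmeasurable (cup X Y).
Proof.
  intros HX HY; apply lmeasurable_ext with (fun x => ~ (dif (fun x => ~ X x) Y x)).
  - intros x; unfold dif, cup; tauto.
  - apply lmeasurable_compl, lmeasurable_dif; auto using lmeasurable_compl.
Qed.

Lemma lmeasurable_empty : lmeasurable (fun _ => False).
Proof.
  apply lmeasurable_intro; intros E HE.
  rewrite (mu_empty (cap E _)) by (intros x []; tauto).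
  rewrite (mu_ext (dif E (fun _ => False)) E) by (intros x; unfold dif; tauto); lra.
Qed.

Lemma lmeasurable_exists_list (I : Type) (l : list I) (X : I -> R -> Prop) :
  (forall i, In i l -> lmeasurable (X i)) ->
  lmeasurable (fun x => exists i, In i l /\ X i x).
Proof.
  induction l as [|i l IH]; intros H.
  - eapply lmeasurable_ext; [|apply lmeasurable_empty].
    intros x; split; [tauto|intros (i & [] & _)].
  - eapply lmeasurable_ext; [|apply (lmeasurable_cup (X i)); [apply H; now left|]].
    2: apply IH; intros j Hj; apply H; now right.
    intros x; split.
    + intros [Hx|(j & Hj & Hx)]; [exists i|exists j]; split; auto; [now left|now right].
    + intros (j & [->|Hj] & Hx); [now left|right; now exists j].
Qed.

Lemma mu_add (A B : R -> Prop) :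
  lmeasurable A -> finite_outer A -> finite_outer B -> (forall x, ~ (A x /\ B x)) ->
  mu (cup A B) = mu A + mu B.
Proof.
  intros HA fA fB H; rewrite (mu_split A (cup A B)) by auto using finite_cup.
  f_equal; apply mu_ext; intros x; specialize (H x); unfold cup, cap, dif; tauto.
Qed.

Lemma mu_le_of_cover (A : R -> Prop) (a b : nat -> R) (s : R) :
  (forall i, a i <= b i) -> (forall x, A x -> exists i, a i < x < b i) ->
  (forall N, sum_f_R0 (fun i => b i - a i) N <= s) -> mu A <= s.
Proof.
  intros Hab Hc Hs; apply mu_le; intros eps Heps; exists a, b.
  split; [exact Hab|split; [exact Hc|]]; intros N; specialize (Hs N); lra.
Qed.

(** * Half-lines and intervals *)

(** Each interval of a nearly optimal cover of [E] is cut at [s]. The left parts cover what lies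
    below [s], the right parts what lies above, and the lengths of the two parts add up to the
    original length. *)
Lemma lmeasurable_lt (s : R) : lmeasurable (fun x => x < s).
Proof.
  apply lmeasurable_intro; intros E HE; apply le_epsilon; intros eps Heps.
  destruct (mu_outer_le E HE (eps / 2) ltac:(lra)) as (a & b & Hab & Hc & Hs).
  set (a1 i := Rmin (a i) s); set (b1 i := Rmin (b i) s).
  set (a2 i := Rmax (a i) s); set (b2 i := Rmax (b i) s).
  (* The truncated open intervals on the right miss the point [s], so it is left out of [E2]; [Hd]
     restores it at zero cost. *)
  set (E2 := cap E (fun x => s < x)).
  assert (Hd : mu (dif E (fun x => x < s)) <= mu E2).
  { replace (mu E2) with (mu E2 + (s - s)) by lra.
    apply mu_le, outer_le_subset with (cup E2 (fun x => s <= x <= s)).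
    - intros x [Hx Hxs]; destruct (Rtotal_order x s) as [h|[h|h]]; [lra|right; lra|].
      left; now split.
    - apply outer_le_cup; [now apply mu_outer_le, finite_cap|apply outer_le_interval; lra]. }
  assert (Hab1 : forall i, a1 i <= b1 i).
  { intros i; specialize (Hab i); unfold a1, b1, Rmin.
    destruct (Rle_dec (a i) s), (Rle_dec (b i) s); lra. }
  assert (Hab2 : forall i, a2 i <= b2 i).
  { intros i; specialize (Hab i); unfold a2, b2, Rmax.
    destruct (Rle_dec (a i) s), (Rle_dec (b i) s); lra. }
  (* If all partial sums stayed below this bound, the truncated intervals would be a cover too short
     for the measure. *)
  assert (H1 : exists N, mu (cap E (fun x => x < s)) - eps / 4 <
                         sum_f_R0 (fun i => b1 i - a1 i) N).
  { apply NNPP; intros Hno.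
    assert (mu (cap E (fun x => x < s)) <= mu (cap E (fun x => x < s)) - eps / 4); [|lra].
    apply (mu_le_of_cover _ a1 b1); [exact Hab1| |].
    - intros x [Hx Hxs]; destruct (Hc x Hx) as [i Hi]; exists i; unfold a1, b1, Rmin.
      destruct (Rle_dec (a i) s), (Rle_dec (b i) s); lra.
    - intros N; apply Rnot_lt_le; eauto. }
  assert (H2 : exists N, mu E2 - eps / 4 < sum_f_R0 (fun i => b2 i - a2 i) N).
  { apply NNPP; intros Hno.
    assert (mu E2 <= mu E2 - eps / 4); [|lra].
    apply (mu_le_of_cover _ a2 b2); [exact Hab2| |].
    - intros x [Hx Hxs]; destruct (Hc x Hx) as [i Hi]; exists i; unfold a2, b2, Rmax.
      destruct (Rle_dec (a i) s), (Rle_dec (b i) s); lra.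
    - intros N; apply Rnot_lt_le; eauto. }
  destruct H1 as [N1 H1], H2 as [N2 H2].
  assert (Hpos1 : forall i, 0 <= b1 i - a1 i) by (intros i; specialize (Hab1 i); lra).
  assert (Hpos2 : forall i, 0 <= b2 i - a2 i) by (intros i; specialize (Hab2 i); lra).
  pose proof (sum_f_R0_mono _ N1 (Nat.max N1 N2) Hpos1 ltac:(lia)) as M1.
  pose proof (sum_f_R0_mono _ N2 (Nat.max N1 N2) Hpos2 ltac:(lia)) as M2.
  specialize (Hs (Nat.max N1 N2)).
  assert (Heq : sum_f_R0 (fun i => b i - a i) (Nat.max N1 N2) =
    sum_f_R0 (fun i => b1 i - a1 i) (Nat.max N1 N2) +
    sum_f_R0 (fun i => b2 i - a2 i) (Nat.max N1 N2)).
  { rewrite <- plus_sum; apply sum_eq; intros i _; unfold a1, b1, a2, b2, Rmin, Rmax.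
    destruct (Rle_dec (a i) s), (Rle_dec (b i) s); lra. }
  lra.
Qed.

Lemma lmeasurable_Ico (a b : R) : lmeasurable (Ico a b).
Proof.
  apply lmeasurable_ext with (dif (fun x => x < b) (fun x => x < a)).
  - intros x; unfold dif, Ico; lra.
  - apply lmeasurable_dif; apply lmeasurable_lt.
Qed.

(* The supremum of the points [x] for which finitely many of the intervals, truncated at [x],
   already have total length [x - a] cannot be less than [b]. *)
Lemma cover_length (a b : R) (u v : nat -> R) :
  a <= b -> (forall i, u i <= v i) ->
  (forall x, a <= x <= b -> exists i, u i < x < v i) ->
  exists N, b - a <= sum_f_R0 (fun i => v i - u i) N.
Proof.
  intros Hab Huv Hc.
  set (f x i := Rmax 0 (Rmin (v i) x - u i)).
  assert (Hf : forall x i, 0 <= f x i) by (intros; apply Rmax_l).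
  assert (Hmono : forall x y i, x <= y -> f x i <= f y i).
  { intros x y i Hxy; unfold f, Rmax, Rmin.
    destruct (Rle_dec (v i) x), (Rle_dec (v i) y);
      repeat destruct (Rle_dec _ _); lra. }
  set (P x := a <= x <= b /\ exists N, x - a <= sum_f_R0 (f x) N).
  destruct (completeness P) as [s [Hub Hlub]].
  - exists b; intros x [Hx _]; lra.
  - exists a; split; [lra|]; exists O; simpl; pose proof (Hf a O); lra.
  - assert (Has : a <= s).
    { apply Hub; split; [lra|]; exists O; simpl; pose proof (Hf a O); lra. }
    assert (Hsb : s <= b) by (apply Hlub; intros x [Hx _]; lra).
    destruct (Hc s ltac:(lra)) as [j [Hj1 Hj2]].
    assert (HP : exists x, P x /\ u j < x).
    { apply NNPP; intros Hno; assert (s <= u j); [|lra].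
      apply Hlub; intros x Hx; apply Rnot_lt_le; eauto. }
    destruct HP as [x [[Hx [N HN]] Hux]].
    assert (Hxs : x <= s) by (apply Hub; split; eauto).
    (* The interval [j] contains [s], so adding it carries the property [P] from [x] to [y]. Since
       [s < v j], the bound [y <= s] can only hold with [y = b]. *)
    set (y := Rmin (v j) b).
    assert (Hy : x <= y <= b /\ y <= v j).
    { unfold y, Rmin; destruct (Rle_dec (v j) b); lra. }
    assert (HPy : P y).
    { split; [lra|]; exists (Nat.max N j).
      apply Rle_trans with (sum_f_R0 (f x) (Nat.max N j) + (y - x)).
      - pose proof (sum_f_R0_mono (f x) N (Nat.max N j) (Hf x) ltac:(lia)); lra.
      - assert (H : y - x <= sum_f_R0 (fun i => f y i - f x i) (Nat.max N j)).
        { apply Rle_trans with (f y j - f x j).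
          - unfold f; rewrite !Rmin_right, !Rmax_right by lra; lra.
          - apply (sum_f_R0_term (fun i => f y i - f x i)); [|lia].
            intros i; pose proof (Hmono x y i ltac:(lra)); lra. }
        rewrite minus_sum in H; lra. }
    pose proof (Hub y HPy) as Hys.
    assert (Hyb : y = b).
    { unfold y, Rmin in *; destruct (Rle_dec (v j) b); lra. }
    destruct HPy as [_ [M HM]]; exists M; rewrite Hyb in HM.
    eapply Rle_trans; [exact HM|]; apply sum_Rle; intros i _.
    specialize (Huv i); unfold f, Rmax, Rmin.
    destruct (Rle_dec (v i) b); repeat destruct (Rle_dec _ _); lra.
Qed.

Lemma mu_Ico (a b : R) : a <= b -> mu (Ico a b) = b - a.
Proof.
  intros Hab; apply Rle_antisym.
  - apply mu_le, outer_le_subset with (fun x => a <= x <= b).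
    + intros x Hx; unfold Ico in Hx; lra.
    + now apply outer_le_interval.
  - assert (Hf : finite_outer (Ico a b)).
    { exists (b - a); apply outer_le_subset with (fun x => a <= x <= b).
      - intros x Hx; unfold Ico in Hx; lra.
      - now apply outer_le_interval. }
    (* The endpoint [b] is added at the cost [b - b], since [cover_length] needs a closed
       interval. *)
    assert (Hcl : outer_le (fun x => a <= x <= b) (mu (Ico a b) + (b - b))).
    { eapply outer_le_subset; [|apply outer_le_cup; [apply mu_outer_le, Hf|]].
      2: apply (outer_le_interval b b); lra.
      intros x Hx; destruct (Rlt_dec x b); [left|right]; unfold Ico; lra. }
    apply le_epsilon; intros eps Heps.
    destruct (Hcl eps Heps) as (u & v & Huv & Hc & Hs).
    destruct (cover_length a b u v Hab Huv Hc) as [N HN].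
    specialize (Hs N); lra.
Qed.

Lemma finite_Ico (a b : R) : finite_outer (Ico a b).
Proof.
  destruct (Rle_dec a b) as [Hab|Hab].
  - exists (b - a); apply outer_le_subset with (fun x => a <= x <= b).
    + intros x Hx; unfold Ico in Hx; lra.
    + now apply outer_le_interval.
  - exists (0 - 0); apply outer_le_subset with (fun x => 0 <= x <= 0).
    + intros x Hx; unfold Ico in Hx; lra.
    + apply outer_le_interval; lra.
Qed.

Lemma finite_in_Ico (a b : R) (A : R -> Prop) : subset A (Ico a b) -> finite_outer A.
Proof. intros H; apply finite_subset with (Ico a b); [exact H|apply finite_Ico]. Qed.

Lemma unit_color_set_iff (m : R) (S : R -> Prop) :
  unit_color_set m S <-> subset S (Ico 0 m) /\ lmeasurable S /\ mu S = 1.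
Proof.
  split.
  - intros (H1 & H2 & H3); split; [exact H1|split; [exact H2|now apply mu_unique]].
  - intros (H1 & H2 & H3); split; [exact H1|split; [exact H2|]].
    rewrite <- H3; apply mu_spec, (finite_in_Ico 0 m), H1.
Qed.

(** * Finite sums and integrals of simple functions *)

Fixpoint lsum {I : Type} (f : I -> R) (l : list I) : R :=
  match l with nil => 0 | i :: l => f i + lsum f l end.

Definition indic (P : Prop) : R := if excluded_middle_informative P then 1 else 0.

Lemma indic_true (P : Prop) : P -> indic P = 1.
Proof. intros H; unfold indic; destruct (excluded_middle_informative P); tauto. Qed.

Lemma indic_false (P : Prop) : ~ P -> indic P = 0.
Proof. intros H; unfold indic; destruct (excluded_middle_informative P); tauto. Qed.

Lemma indic_iff (P Q : Prop) : (P <-> Q) -> indic P = indic Q.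
Proof.
  intros H; unfold indic.
  destruct (excluded_middle_informative P), (excluded_middle_informative Q); tauto.
Qed.

Lemma lsum_ext (I : Type) (f g : I -> R) (l : list I) :
  (forall i, In i l -> f i = g i) -> lsum f l = lsum g l.
Proof.
  induction l as [|i l IH]; intros H; simpl; [reflexivity|].
  rewrite (H i), IH; [reflexivity| |now left]; intros j Hj; apply H; now right.
Qed.

Lemma lsum_le (I : Type) (f g : I -> R) (l : list I) :
  (forall i, In i l -> f i <= g i) -> lsum f l <= lsum g l.
Proof.
  induction l as [|i l IH]; intros H; simpl; [lra|].
  assert (lsum f l <= lsum g l) by (apply IH; intros j Hj; apply H; now right).
  specialize (H i (or_introl eq_refl)); lra.
Qed.

Lemma lsum_plus (I : Type) (f g : I -> R) (l : list I) :
  lsum (fun i => f i + g i) l = lsum f l + lsum g l.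
Proof. induction l as [|i l IH]; simpl; [|rewrite IH]; lra. Qed.

Lemma lsum_scal (I : Type) (a : R) (f : I -> R) (l : list I) :
  lsum (fun i => a * f i) l = a * lsum f l.
Proof. induction l as [|i l IH]; simpl; [|rewrite IH]; lra. Qed.

Lemma lsum_const (I : Type) (a : R) (l : list I) :
  lsum (fun _ => a) l = INR (length l) * a.
Proof.
  induction l as [|i l IH]; [simpl; lra|].
  simpl lsum; rewrite IH; simpl length; rewrite S_INR; lra.
Qed.

Lemma lsum_exchange (I J : Type) (f : I -> J -> R) (l : list I) (l' : list J) :
  lsum (fun i => lsum (f i) l') l = lsum (fun j => lsum (fun i => f i j) l) l'.
Proof.
  induction l as [|i l IH]; simpl.
  - rewrite lsum_const; lra.
  - rewrite IH, lsum_plus; reflexivity.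
Qed.

Lemma lsum_app (I : Type) (f : I -> R) (l l' : list I) :
  lsum f (l ++ l') = lsum f l + lsum f l'.
Proof. induction l as [|i l IH]; simpl; [|rewrite IH]; lra. Qed.

Lemma lsum_map (I J : Type) (h : I -> J) (f : J -> R) (l : list I) :
  lsum f (map h l) = lsum (fun i => f (h i)) l.
Proof. induction l as [|i l IH]; simpl; [|rewrite IH]; lra. Qed.

(* Integration of a simple function, by splitting [B] along one set at a time. *)
Lemma lsum_mu_le (I : Type) (l : list I) (a : I -> R) (X : I -> R -> Prop) :
  (forall i, In i l -> lmeasurable (X i)) ->
  forall (B : R -> Prop) (r : R), finite_outer B ->
  (forall x, B x -> lsum (fun i => a i * indic (X i x)) l <= r) ->
  lsum (fun i => a i * mu (cap B (X i))) l <= r * mu B.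
Proof.
  induction l as [|i l IH]; intros HX B r HB H; simpl in *.
  - destruct (classic (exists x, B x)) as [[x Hx]|Hno].
    + apply Rmult_le_pos; [apply (H x Hx)|apply mu_nonneg].
    + rewrite (mu_empty B) by eauto; lra.
  - assert (HXi : lmeasurable (X i)) by (apply HX; now left).
    assert (HXl : forall j, In j l -> lmeasurable (X j)) by (intros; apply HX; now right).
    rewrite (mu_split (X i) B HXi HB).
    assert (H1 : lsum (fun j => a j * mu (cap (cap B (X i)) (X j))) l <=
                 (r - a i) * mu (cap B (X i))).
    { apply IH; auto using finite_cap; intros x [Hx HXx]; specialize (H x Hx).
      rewrite indic_true in H by exact HXx; lra. }
    assert (H2 : lsum (fun j => a j * mu (cap (dif B (X i)) (X j))) l <=
                 r * mu (dif B (X i))).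
    { apply IH; auto using finite_dif; intros x [Hx HXx]; specialize (H x Hx).
      rewrite indic_false in H by exact HXx; lra. }
    assert (H3 : lsum (fun j => a j * mu (cap B (X j))) l =
      lsum (fun j => a j * mu (cap (cap B (X i)) (X j))) l +
      lsum (fun j => a j * mu (cap (dif B (X i)) (X j))) l).
    { rewrite <- lsum_plus; apply lsum_ext; intros j Hj.
      rewrite (mu_split (X i) (cap B (X j))) by auto using finite_cap.
      rewrite Rmult_plus_distr_l; f_equal; f_equal;
        apply mu_ext; intros x; unfold cap, dif; tauto. }
    lra.
Qed.

Lemma lsum_mu_eq (I : Type) (l : list I) (a : I -> R) (X : I -> R -> Prop)
    (B : R -> Prop) (r : R) :
  (forall i, In i l -> lmeasurable (X i)) -> finite_outer B ->
  (forall x, B x -> lsum (fun i => a i * indic (X i x)) l = r) ->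
  lsum (fun i => a i * mu (cap B (X i))) l = r * mu B.
Proof.
  intros HX HB H; apply Rle_antisym.
  - apply lsum_mu_le; auto; intros x Hx; rewrite H by exact Hx; lra.
  (* The reverse inequality is [lsum_mu_le] for the negated coefficients. *)
  - assert (H' : lsum (fun i => - a i * mu (cap B (X i))) l <= - r * mu B).
    { apply lsum_mu_le; auto; intros x Hx.
      rewrite (lsum_ext _ _ (fun i => -1 * (a i * indic (X i x)))) by (intros; lra).
      rewrite lsum_scal, H by exact Hx; lra. }
    rewrite (lsum_ext _ _ (fun i => -1 * (a i * mu (cap B (X i))))) in H' by (intros; lra).
    rewrite lsum_scal in H'; lra.
Qed.

(** * Upper bound *)

Lemma mu_cap_lt_lipschitz (A : R -> Prop) (s t : R) :
  finite_outer A -> s <= t ->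
  mu (cap A (fun x => x < s)) <= mu (cap A (fun x => x < t)) <=
  mu (cap A (fun x => x < s)) + (t - s).
Proof.
  intros HA Hst; split.
  - apply mu_mono; [|now apply finite_cap]; intros x [Hx Hxs]; split; [exact Hx|lra].
  - rewrite <- (mu_Ico s t Hst).
    eapply Rle_trans; [|apply mu_cup_le; [now apply finite_cap|apply finite_Ico]].
    apply mu_mono; [|apply finite_cup; [now apply finite_cap|apply finite_Ico]].
    intros x [Hx Hxt]; destruct (Rlt_dec x s); [left; now split|right; unfold Ico; lra].
Qed.

(** The measure of the part of [A] below [s] is 1-Lipschitz in [s] and rises from 0 to [mu A], so
    the intermediate value theorem yields a suitable cut. *)
Lemma exists_subset_mu (K : R) (A : R -> Prop) (theta : R) :
  subset A (Ico 0 K) -> lmeasurable A -> 0 <= theta <= 1 ->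
  exists A1, lmeasurable A1 /\ subset A1 A /\ mu A1 = theta * mu A.
Proof.
  intros HA mA Ht; assert (fA : finite_outer A) by now apply finite_in_Ico in HA.
  pose proof (mu_nonneg A) as Hpos.
  assert (Hs : exists s, mu (cap A (fun x => x < s)) = theta * mu A).
  { set (g s := mu (cap A (fun x => x < s)) - theta * mu A).
    assert (Hg : continuity g).
    { intros x eps Heps; exists eps; split; [exact Heps|].
      intros y [_ Hy]; simpl in *; unfold Rdist, g in *.
      apply Rabs_def2 in Hy; apply Rabs_def1;
        destruct (Rle_dec x y) as [h|h];
        [pose proof (mu_cap_lt_lipschitz A x y fA h)|
         pose proof (mu_cap_lt_lipschitz A y x fA ltac:(lra))|
         pose proof (mu_cap_lt_lipschitz A x y fA h)|
         pose proof (mu_cap_lt_lipschitz A y x fA ltac:(lra))]; lra. }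
    set (M := Rmax 0 K).
    assert (HM : 0 <= M /\ K <= M) by (split; [apply Rmax_l|apply Rmax_r]).
    assert (H0 : mu (cap A (fun x => x < 0)) = 0).
    { apply mu_empty; intros x [Hx Hx0]; apply HA in Hx; unfold Ico in Hx; lra. }
    assert (H1 : mu (cap A (fun x => x < M)) = mu A).
    { apply mu_ext; intros x; split; [now intros []|intros Hx; split; [exact Hx|]].
      apply HA in Hx; unfold Ico in Hx; lra. }
    destruct (IVT_cor g 0 M Hg (proj1 HM)) as [s [_ Hs]].
    - unfold g; rewrite H0, H1.
      assert (0 <= theta * mu A * ((1 - theta) * mu A)); [|lra].
      apply Rmult_le_pos; apply Rmult_le_pos; lra.
    - exists s; unfold g in Hs; lra. }
  destruct Hs as [s Hs]; exists (cap A (fun x => x < s)); split; [|split; [|exact Hs]].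
  - apply lmeasurable_cap; [exact mA|apply lmeasurable_lt].
  - now intros x [].
Qed.

(** Induction on [L]: [A] is split along the first set [p], a proportional subset is taken in each
    of the two pieces, and their union is proportional for [p] as well. *)
Lemma exists_subset_proportional (K : R) (L : list (R -> Prop)) (theta : R) :
  0 <= theta <= 1 -> (forall p, In p L -> lmeasurable p) ->
  forall A, subset A (Ico 0 K) -> lmeasurable A ->
  exists A1, lmeasurable A1 /\ subset A1 A /\ mu A1 = theta * mu A /\
    forall p, In p L -> mu (cap A1 p) = theta * mu (cap A p).
Proof.
  intros Ht; induction L as [|p L IH]; intros HL A HA mA.
  - destruct (exists_subset_mu K A theta HA mA Ht) as (A1 & H1 & H2 & H3).
    exists A1; repeat split; auto; intros p [].
  - assert (mp : lmeasurable p) by (apply HL; now left).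
    assert (HL' : forall p, In p L -> lmeasurable p) by (intros; apply HL; now right).
    assert (fA : finite_outer A) by now apply finite_in_Ico in HA.
    destruct (IH HL' (cap A p)) as (B & mB & HB & eB & pB);
      [intros x []; auto|now apply lmeasurable_cap|].
    destruct (IH HL' (dif A p)) as (C & mC & HC & eC & pC);
      [intros x []; auto|now apply lmeasurable_dif|].
    assert (fB : finite_outer B) by (apply finite_subset with (cap A p); auto using finite_cap).
    assert (fC : finite_outer C) by (apply finite_subset with (dif A p); auto using finite_dif).
    exists (cup B C); split; [now apply lmeasurable_cup|split; [|split]].
    + intros x [Hx|Hx]; [apply HB in Hx|apply HC in Hx]; now destruct Hx.
    + rewrite mu_add, eB, eC, (mu_split p A) by
        (auto; intros x [Hx Hx']; apply HB in Hx; apply HC in Hx'; destruct Hx, Hx'; tauto).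
      lra.
    + intros q [<-|Hq].
      * rewrite <- eB; apply mu_ext; intros x; unfold cap, cup.
        specialize (HB x); specialize (HC x); unfold cap, dif in *; tauto.
      * rewrite (mu_split B (cap (cup B C) q)) by auto using finite_cap, finite_cup.
        rewrite (mu_split p (cap A q)) by auto using finite_cap.
        rewrite Rmult_plus_distr_l.
        rewrite (mu_ext (cap (cap A q) p) (cap (cap A p) q)) by (intros; unfold cap; tauto).
        rewrite (mu_ext (dif (cap A q) p) (cap (dif A p) q)) by
          (intros; unfold cap, dif; tauto).
        rewrite <- pB, <- pC by exact Hq.
        f_equal; apply mu_ext; intros x; specialize (HB x); specialize (HC x);
          unfold cap, dif, cup in *; tauto.
Qed.

(** * Transport of a coloring *)

(** [A] plays the role of a copy of [B] that is spread evenly over the sets of [L]. The last class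
    [c n] cuts [B] in two; a proportional part [A1] of [A] is reserved for [cap B (c n)], and the
    remaining classes are copied recursively into [A1] and into the rest of [A]. *)
Lemma transport_generic (K : R) (L : list (R -> Prop)) (c : nat -> R -> Prop) (n : nat) :
  0 < K -> (forall p, In p L -> lmeasurable p) -> (forall v, (v < n)%nat -> lmeasurable (c v)) ->
  forall B A, lmeasurable B -> finite_outer B -> lmeasurable A -> subset A (Ico 0 K) ->
  (forall p, In p L -> mu (cap A p) = mu B / K * mu p) ->
  exists d : nat -> R -> Prop,
    (forall v, (v < n)%nat -> lmeasurable (d v) /\ subset (d v) A /\
      forall p, In p L -> mu (cap (d v) p) = mu (cap B (c v)) / K * mu p) /\
    (forall u v, (u < n)%nat -> (v < n)%nat -> u <> v ->
      (forall x, B x -> ~ (c u x /\ c v x)) -> forall x, ~ (d u x /\ d v x)).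
Proof.
  intros HK HL; induction n as [|n IH]; intros Hc B A mB fB mA HA HAL.
  - exists c; split; intros; lia.
  - assert (mcn : lmeasurable (c n)) by (apply Hc; lia).
    assert (Hc' : forall v, (v < n)%nat -> lmeasurable (c v)) by (intros; apply Hc; lia).
    assert (fA : finite_outer A) by now apply finite_in_Ico in HA.
    set (b := mu B) in *; set (b1 := mu (cap B (c n))).
    assert (Hb : b = b1 + mu (dif B (c n))) by now apply mu_split.
    assert (Hb1 : 0 <= b1) by apply mu_nonneg.
    pose proof (mu_nonneg (dif B (c n))) as Hb2.
    (* [t] is the share [b1 / b] of [B] taken by [c n]. If [b = 0] then [b1 = 0] too, and [t = 0]
       serves. *)
    assert (Ht : exists t, 0 <= t <= 1 /\ t * b = b1).
    { destruct (Req_dec b 0) as [h|h].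
      - exists 0; lra.
      - exists (b1 / b); split; [split|].
        + apply Rmult_le_pos; [lra|apply Rlt_le, Rinv_0_lt_compat; lra].
        + apply Rmult_le_reg_r with b; [lra|]; unfold Rdiv.
          rewrite Rmult_assoc, Rinv_l by lra; lra.
        + field; exact h. }
    destruct Ht as [t [Ht Htb]].
    destruct (exists_subset_proportional K L t Ht HL A HA mA) as (A1 & mA1 & HA1 & _ & eA1).
    assert (H1 : forall p, In p L -> mu (cap A1 p) = b1 / K * mu p).
    { intros p Hp; rewrite eA1, HAL, <- Htb by exact Hp; field; lra. }
    assert (H2 : forall p, In p L -> mu (cap (dif A A1) p) = mu (dif B (c n)) / K * mu p).
    { intros p Hp; pose proof (mu_split A1 (cap A p) mA1 (finite_cap _ _ fA)) as Hs.
      rewrite (mu_ext (cap (cap A p) A1) (cap A1 p)) in Hs by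
        (intros x; specialize (HA1 x); unfold cap; tauto).
      rewrite (mu_ext (dif (cap A p) A1) (cap (dif A A1) p)) in Hs by
        (intros x; unfold cap, dif; tauto).
      rewrite HAL, H1 in Hs by exact Hp.
      replace (mu (dif B (c n))) with (b - b1) by lra.
      unfold Rdiv in *; rewrite !Rmult_minus_distr_r; lra. }
    destruct (IH Hc' (cap B (c n)) A1) as (d1 & P1 & Q1);
      auto using lmeasurable_cap, finite_cap; [intros x Hx; auto|].
    destruct (IH Hc' (dif B (c n)) (dif A A1)) as (d2 & P2 & Q2);
      auto using lmeasurable_dif, finite_dif; [intros x []; auto|].
    (* Only measures of [d1 v] are prescribed, so it may be nonempty although [c n] and [c v] are
       disjoint on [B]. Discarding it unless they meet makes the copies exactly disjoint, not just
       up to measure zero. *)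
    set (meet v := exists x, cap B (c n) x /\ c v x).
    exists (fun v x => if Nat.eq_dec v n then A1 x else (meet v /\ d1 v x) \/ d2 v x).
    split.
    + intros v Hv; destruct (Nat.eq_dec v n) as [->|Hvn].
      * split; [exact mA1|split; [exact HA1|exact H1]].
      * destruct (P1 v ltac:(lia)) as (m1 & s1 & e1).
        destruct (P2 v ltac:(lia)) as (m2 & s2 & e2).
        assert (f1 : finite_outer (d1 v)).
        { apply finite_subset with A; [|exact fA]; intros x Hx; auto. }
        assert (f2 : finite_outer (d2 v)).
        { apply finite_subset with A; [|exact fA]; intros x Hx; now destruct (s2 x Hx). }
        assert (md : lmeasurable (fun x => meet v /\ d1 v x)).
        { destruct (classic (meet v)) as [h|h].
          - apply lmeasurable_ext with (d1 v); [tauto|exact m1].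
          - apply lmeasurable_ext with (fun _ => False); [tauto|apply lmeasurable_empty]. }
        split; [|split].
        -- now apply (lmeasurable_cup (fun x => meet v /\ d1 v x)).
        -- intros x [[_ Hx]|Hx]; [auto|now destruct (s2 x Hx)].
        -- intros p Hp.
           rewrite (mu_split (c n) (cap B (c v))) by auto using finite_cap.
           rewrite (mu_ext (cap (cap B (c v)) (c n)) (cap (cap B (c n)) (c v))) by
             (intros x; unfold cap; tauto).
           rewrite (mu_ext (dif (cap B (c v)) (c n)) (cap (dif B (c n)) (c v))) by
             (intros x; unfold cap, dif; tauto).
           assert (f12 : finite_outer (fun x => (meet v /\ d1 v x) \/ d2 v x)).
           { apply finite_subset with (cup (d1 v) (d2 v)); [|now apply finite_cup].
             intros x [[_ Hx]|Hx]; [left|right]; exact Hx. }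
           rewrite (mu_split A1 (cap _ p) mA1 (finite_cap _ p f12)).
           unfold Rdiv in *; rewrite !Rmult_plus_distr_r; f_equal.
           ++ destruct (classic (meet v)) as [h|h].
              ** rewrite <- (e1 p Hp); apply mu_ext; intros x.
                 specialize (s1 x); specialize (s2 x); unfold cap, dif in *; tauto.
              ** rewrite (mu_empty (cap (cap B (c n)) (c v))) by
                   (intros x [Hx Hx']; apply h; now exists x).
                 rewrite mu_empty; [lra|].
                 intros x; specialize (s2 x); unfold cap, dif in *; tauto.
           ++ rewrite <- (e2 p Hp); apply mu_ext; intros x.
              specialize (s1 x); specialize (s2 x); unfold cap, dif in *; tauto.
    + assert (Hn : forall v, (v < n)%nat -> (forall x, B x -> ~ (c n x /\ c v x)) ->
        forall x, ~ (A1 x /\ ((meet v /\ d1 v x) \/ d2 v x))).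
      { intros v Hv Hdis x [Hx [[[y [[Hy Hy'] Hy'']] _]|Hx']].
        - now apply (Hdis y Hy).
        - destruct (P2 v Hv) as (_ & s2 & _); now destruct (s2 x Hx'). }
      intros u v Hu Hv Huv Hdis x.
      destruct (Nat.eq_dec u n) as [->|Hun], (Nat.eq_dec v n) as [->|Hvn].
      * tauto.
      * apply Hn; [lia|exact Hdis].
      * intros [Hx Hx']; apply (Hn u) with x; [lia| |tauto].
        intros y Hy [h h']; now apply (Hdis y Hy).
      * destruct (P1 u ltac:(lia)) as (_ & s1u & _), (P1 v ltac:(lia)) as (_ & s1v & _).
        destruct (P2 u ltac:(lia)) as (_ & s2u & _), (P2 v ltac:(lia)) as (_ & s2v & _).
        intros [[[_ Hx]|Hx] [[_ Hx']|Hx']].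
        -- apply (Q1 u v ltac:(lia) ltac:(lia) Huv) with x; [|now split].
           intros y [Hy _]; now apply Hdis.
        -- destruct (s2v x Hx') as [_ h]; now apply h, s1u.
        -- destruct (s2u x Hx) as [_ h]; now apply h, s1v.
        -- apply (Q2 u v ltac:(lia) ltac:(lia) Huv) with x; [|now split].
           intros y [Hy _]; now apply Hdis.
Qed.

(** * Extending a precoloring *)

(** Three pairwise disjoint sets of measure one do not fit into an interval of length below 3. *)
Lemma frac_coloring_triangle_free (G : graph) (k : R) (c : nat -> R -> Prop) (u v w : nat) :
  k < 3 -> frac_coloring G k c -> adj G u v -> adj G v w -> adj G u w -> False.
Proof.
  intros Hk [Hc Hd] Huv Hvw Huw.
  destruct (adj_range G u v Huv) as [Hu Hv], (adj_range G v w Hvw) as [_ Hw].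
  destruct (proj1 (unit_color_set_iff _ _) (Hc u Hu)) as (su & mu' & eu).
  destruct (proj1 (unit_color_set_iff _ _) (Hc v Hv)) as (sv & mv & ev).
  destruct (proj1 (unit_color_set_iff _ _) (Hc w Hw)) as (sw & mw & ew).
  pose proof (finite_in_Ico _ _ _ su) as fu; pose proof (finite_in_Ico _ _ _ sv) as fv.
  pose proof (finite_in_Ico _ _ _ sw) as fw.
  assert (H : mu (cup (c u) (cup (c v) (c w))) = 3).
  { rewrite !mu_add; auto using finite_cup; [lra|].
    intros x [h [h'|h']]; [now apply (Hd u v Huv x)|now apply (Hd u w Huw x)]. }
  assert (Hsub : subset (cup (c u) (cup (c v) (c w))) (Ico 0 k)).
  { intros x [h|[h|h]]; auto. }
  apply mu_mono in Hsub; [|apply finite_Ico].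
  destruct (Rle_dec 0 k) as [h|h].
  - rewrite mu_Ico in Hsub by exact h; lra.
  - rewrite (mu_empty (Ico 0 k)) in Hsub; [lra|intros x; unfold Ico; lra].
Qed.

Lemma extends_of_large_eps (k e : R) (G : graph) (W : nat -> Prop) (p : nat -> R -> Prop) :
  0 < k < 3 -> 0 <= e -> 1 <= e * (e + k - 1) ->
  frac_colorable G k -> far_apart G W 4 -> frac_precoloring (k + e) W p ->
  extends G (k + e) W p.
Proof.
  intros Hk He Hek [c Hc] [HW Hfar] Hp; destruct (Hc) as [Hc1 Hc2].
  set (K := k + e) in *.
  (* Outside [W] nothing is known about [p]; making [p'] empty there keeps every member of [L]
     measurable. *)
  set (p' v x := W v /\ p v x).
  (* The whole interval belongs to [L], so that proportionality also fixes the total measures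
     [mu (d v) = 1] and [mu O = e]. *)
  set (L := Ico 0 K :: map p' (seq 0 (nv G))).
  assert (HL : forall q, In q L -> lmeasurable q /\ subset q (Ico 0 K)).
  { intros q [<-|Hq]; [split; [apply lmeasurable_Ico|now intros x]|].
    apply in_map_iff in Hq; destruct Hq as (v & <- & _).
    destruct (classic (W v)) as [h|h].
    - destruct (Hp v h) as (s & m & _); split.
      + apply lmeasurable_ext with (p v); [unfold p'; tauto|exact m].
      + intros x [_ Hx]; now apply s.
    - split; [|now intros x []].
      apply lmeasurable_ext with (fun _ => False); [unfold p'; tauto|apply lmeasurable_empty]. }
  assert (HLK : In (Ico 0 K) L) by now left.
  assert (HLp : forall w, W w -> In (p' w) L).
  { intros w Hw; right; apply in_map, in_seq; apply HW in Hw; lia. }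
  assert (Hmp : forall w, W w -> mu (p' w) = 1).
  { intros w Hw; destruct (proj1 (unit_color_set_iff _ _) (Hp w Hw)) as (_ & _ & <-); apply mu_ext; unfold p'; tauto. }
  assert (HmK : mu (Ico 0 K) = K) by (rewrite mu_Ico; unfold K; lra).
  destruct (exists_subset_proportional K L (k / K)) with (A := Ico 0 K)
    as (A & mA & HA & _ & eA); [|intros; now apply HL|now intros x|apply lmeasurable_Ico|].
  { split; [apply Rmult_le_pos; [lra|apply Rlt_le, Rinv_0_lt_compat; unfold K; lra]|].
    apply Rmult_le_reg_r with K; [unfold K; lra|].
    unfold Rdiv; rewrite Rmult_assoc, Rinv_l; unfold K; lra. }
  assert (eA' : forall q, In q L -> mu (cap A q) = mu (Ico 0 k) / K * mu q).
  { intros q Hq; rewrite mu_Ico, Rminus_0_r, eA by (lra || exact Hq); f_equal.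
    apply mu_ext; intros x; destruct (HL q Hq) as [_ h]; specialize (h x); unfold cap; tauto. }
  destruct (transport_generic K L c (nv G)) with (B := Ico 0 k) (A := A)
    as (d & Hd1 & Hd2); auto using lmeasurable_Ico, finite_Ico.
  { unfold K; lra. }
  { intros; now apply HL. }
  { intros v Hv; now apply Hc1. }
  assert (Hcd : forall v q, (v < nv G)%nat -> In q L -> mu (cap (d v) q) = 1 / K * mu q).
  { intros v q Hv Hq; destruct (Hd1 v Hv) as (_ & _ & ->); [|exact Hq].
    do 2 f_equal; destruct (proj1 (unit_color_set_iff _ _) (Hc1 v Hv)) as (s & _ & <-).
    apply mu_ext; intros x; specialize (s x); unfold cap; tauto. }
  assert (Hmd : forall v, (v < nv G)%nat -> mu (d v) = 1).
  { intros v Hv; transitivity (mu (cap (d v) (Ico 0 K))).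
    - destruct (Hd1 v Hv) as (_ & s & _); apply mu_ext; intros x.
      specialize (s x); specialize (HA x); unfold cap; tauto.
    - rewrite Hcd, HmK by auto; field; unfold K; lra. }
  set (O := dif (Ico 0 K) A).
  assert (mO : lmeasurable O) by (apply lmeasurable_dif; auto using lmeasurable_Ico).
  assert (HO : subset O (Ico 0 K)) by now intros x [].
  assert (fO : finite_outer O) by now apply finite_in_Ico in HO.
  assert (eO : forall q, In q L -> mu (cap O q) = e / K * mu q).
  { intros q Hq; destruct (HL q Hq) as [mq sq].
    assert (fq : finite_outer q) by now apply finite_in_Ico in sq.
    pose proof (mu_split A q mA fq) as Hs.
    rewrite (mu_ext (cap q A) (cap A q)), eA', mu_Ico in Hs by
      (lra || exact Hq || (intros; unfold cap; tauto)).
    rewrite (mu_ext (cap O q) (dif q A)) by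
      (intros x; specialize (sq x); unfold O, cap, dif; tauto).
    apply Rplus_eq_reg_l with ((k - 0) / K * mu q); rewrite <- Hs; unfold K; field; lra. }
  assert (HmO : mu O = e).
  { transitivity (mu (cap O (Ico 0 K))).
    - apply mu_ext; intros x; unfold O, cap, dif; tauto.
    - rewrite eO, HmK by exact HLK; field; unfold K; lra. }
  (* These properties of the individual color sets are all that the check of the edges below needs,
     so the sets can be chosen vertex by vertex. *)
  assert (Hex : forall v, exists S, (v < nv G)%nat -> unit_color_set K S /\
    (W v -> S = p v) /\
    (~ W v -> subset S (cup (d v) O)) /\
    (~ W v -> forall w, W w -> adj G w v -> forall x, ~ (S x /\ p w x)) /\
    (~ W v -> (forall w, W w -> ~ adj G w v) -> S = d v)).
  { intros v; destruct (classic (v < nv G)%nat) as [Hv|Hv]; [|exists (d v); tauto].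
    destruct (Hd1 v Hv) as (md & sd & _).
    assert (fd : finite_outer (d v)).
    { apply (finite_in_Ico 0 K); intros x Hx; auto. }
    destruct (classic (W v)) as [HWv|HWv].
    { exists (p v); intros _; split; [now apply Hp|]; tauto. }
    destruct (classic (exists w, W w /\ adj G w v)) as [[w [Hw Hwv]]|Hno].
    2:{ exists (d v); intros _; split; [|split; [tauto|split; [intros _ x; now left|split]]].
      - apply unit_color_set_iff; split; [intros x Hx; auto|split; [exact md|now apply Hmd]].
      - intros _ w Hw Hwv; exfalso; eauto.
      - tauto. }
    destruct (HL _ (HLp w Hw)) as [mp sp].
    set (X := dif (cup (d v) O) (p' w)).
    assert (mX : lmeasurable X) by
      (apply lmeasurable_dif; [apply lmeasurable_cup|]; assumption).
    assert (HX : subset X (Ico 0 K)) by (intros x [[Hx|Hx] _]; auto).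
    assert (Hdis : forall x, ~ (d v x /\ O x)) by (intros x [Hx [_ h]]; auto).
    assert (eX : mu X = (1 + e) * (1 - 1 / K)).
    { pose proof (mu_split (p' w) (cup (d v) O) mp (finite_cup _ _ fd fO)) as Hs.
      rewrite mu_add, HmO, Hmd in Hs by auto.
      assert (Hcup : mu (cap (cup (d v) O) (p' w)) = (1 + e) / K).
      { rewrite (mu_ext _ (cup (cap (d v) (p' w)) (cap O (p' w)))) by
          (intros x; unfold cap, cup; tauto).
        rewrite mu_add, Hcd, eO, Hmp; auto using lmeasurable_cap, finite_cap.
        - field; unfold K; lra.
        - intros x [[h _] [h' _]]; now apply (Hdis x). }
      rewrite Hcup in Hs; fold X in Hs.
      apply Rplus_eq_reg_l with ((1 + e) / K); rewrite <- Hs; field; unfold K; lra. }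
    (* The inequality [(1 + e) * (K - 1) >= K] rearranges to [e * (e + k - 1) >= 1]. *)
    assert (gX : 1 <= mu X).
    { rewrite eX; apply Rmult_le_reg_r with K; [unfold K; lra|].
      replace ((1 + e) * (1 - 1 / K) * K) with ((1 + e) * (K - 1)) by (field; unfold K; lra).
      unfold K; lra. }
    destruct (exists_subset_mu K X (/ mu X) HX mX) as (S & mS & HS & eS).
    { split; [apply Rlt_le, Rinv_0_lt_compat; lra|].
      rewrite <- Rinv_1; apply Rinv_le_contravar; lra. }
    rewrite Rinv_l in eS by lra.
    exists S; intros _; split; [|split; [tauto|split; [|split]]].
    - apply unit_color_set_iff; split; [intros x Hx; auto|now split].
    - intros _ x Hx; now destruct (HS x Hx).
    - intros _ w' Hw' Hwv' x [Hx Hx'].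
      destruct (Nat.eq_dec w w') as [<-|Hne].
      + destruct (HS x Hx) as [_ h]; apply h; now split.
      (* A second precolored neighbour of [v] would be at distance at most 2 from [w]. *)
      + assert (h : (4 <= 2)%nat); [|lia].
        apply (Hfar w w' Hw Hw' Hne); econstructor; [exact Hwv|].
        econstructor; [apply adj_sym; exact Hwv'|constructor].
    - intros _ h; exfalso; now apply (h w). }
  destruct (choice _ Hex) as [f Hf]; exists f; split.
  2:{ intros w Hw x; destruct (Hf w (HW w Hw)) as (_ & -> & _); tauto. }
  split; [intros v Hv; now apply Hf|].
  assert (HWV : forall u v, adj G u v -> W u -> forall x, ~ (f u x /\ f v x)).
  { intros u v Huv Wu x [Hu Hv]; destruct (adj_range G u v Huv) as [ru rv].
    destruct (classic (W v)) as [Wv|Wv].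
    - assert (h : (4 <= 1)%nat); [|lia]; apply (Hfar u v Wu Wv).
      + intros ->; now apply (adj_irrefl G v).
      + econstructor; [exact Huv|constructor].
    - destruct (Hf v rv) as (_ & _ & _ & h & _); apply (h Wv u Wu Huv x).
      destruct (Hf u ru) as (_ & <- & _); tauto. }
  (* Here [v] keeps [d v], which is disjoint from [O] and from [d u], and [u] uses only colors of
     [d u] and [O]. *)
  assert (HNV : forall u v, adj G u v -> ~ W u -> ~ W v -> (forall w, W w -> ~ adj G w v) ->
    forall x, ~ (f u x /\ f v x)).
  { intros u v Huv Wu Wv Hno x [Hu Hv]; destruct (adj_range G u v Huv) as [ru rv].
    destruct (Hf v rv) as (_ & _ & _ & _ & h); rewrite (h Wv Hno) in Hv.
    destruct (Hf u ru) as (_ & _ & h' & _); destruct (h' Wu x Hu) as [Hu'|[_ Hu']].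
    - apply (Hd2 u v ru rv) with x; [|intros y _; now apply Hc2|now split].
      intros ->; now apply (adj_irrefl G v).
    - apply Hu', (proj1 (proj2 (Hd1 v rv))), Hv. }
  intros u v Huv x [Hu Hv]; pose proof (adj_sym G u v Huv) as Hvu.
  destruct (classic (W u)) as [Wu|Wu]; [now apply (HWV u v Huv Wu x)|].
  destruct (classic (W v)) as [Wv|Wv]; [now apply (HWV v u Hvu Wv x)|].
  destruct (classic (exists w, W w /\ adj G w v)) as [[w [Hw Hwv]]|Hnv].
  2: now apply (HNV u v Huv Wu Wv ltac:(eauto) x).
  destruct (classic (exists w, W w /\ adj G w u)) as [[w' [Hw' Hwu]]|Hnu].
  2: now apply (HNV v u Hvu Wv Wu ltac:(eauto) x).
  (* Both ends of the edge now have precolored neighbours: a common one closes a triangle, and two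
     different ones are joined by a walk of length 3. *)
  destruct (Nat.eq_dec w w') as [<-|Hne].
  - now apply (frac_coloring_triangle_free G k c w u v).
  - assert (h : (4 <= 3)%nat); [|lia].
    apply (Hfar w w' Hw Hw' Hne); econstructor; [exact Hwv|].
    econstructor; [exact Hvu|]; econstructor; [apply adj_sym; exact Hwu|constructor].
Qed.

(** * Lower bound *)

Definition cnt (P : nat -> Prop) (n : nat) : R := lsum (fun i => indic (P i)) (seq 0 n).

Lemma cnt_S (P : nat -> Prop) (n : nat) : cnt P (S n) = cnt P n + indic (P n).
Proof. unfold cnt; rewrite seq_S, lsum_app; simpl; lra. Qed.

Lemma cnt_interval (a b n : nat) :
  (b <= n)%nat -> cnt (fun i => (a <= i < b)%nat) n = INR (b - a).
Proof.
  intros Hb.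
  assert (H : forall n, cnt (fun i => (a <= i < b)%nat) n = INR (Nat.min b n - a)).
  { clear n Hb; induction n as [|n IH].
    - rewrite Nat.min_0_r; reflexivity.
    - rewrite cnt_S, IH; destruct (classic (a <= n < b)%nat) as [h|h].
      + rewrite indic_true by exact h.
        replace (Nat.min b (S n) - a)%nat with (S (Nat.min b n - a)) by lia.
        now rewrite S_INR.
      + rewrite indic_false, Rplus_0_r by exact h; f_equal; lia. }
  rewrite H; f_equal; lia.
Qed.

Lemma cnt_filter (P : nat -> Prop) (l : list nat) :
  lsum (fun i => indic (P i)) l =
  INR (length (filter (fun i => if excluded_middle_informative (P i) then true else false) l)).
Proof.
  induction l as [|i l IH]; [reflexivity|]; simpl lsum; rewrite IH; unfold indic; simpl filter.
  destruct (excluded_middle_informative (P i)); simpl length; [rewrite S_INR|]; lra.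
Qed.

(** [cdist n i j] is [j - i] modulo [n], for [i, j < n]. *)
Definition cdist (n i j : nat) : nat := if (i <=? j)%nat then (j - i)%nat else (j + n - i)%nat.

Ltac cdist_cases :=
  unfold cdist in *; repeat match goal with
  | |- context [(?a <=? ?b)%nat] => destruct (Nat.leb_spec a b)
  | H : context [(?a <=? ?b)%nat] |- _ => destruct (Nat.leb_spec a b)
  end.

(** * Arcs and circular cliques *)

Definition arc (n m i c : nat) : Prop := (cdist n i c < m)%nat.

(** The circular clique with parameters [n / m]: the cyclic distance is at least [m] in both
    directions. *)
Definition circ_adj (n m i j : nat) : Prop :=
  (i < n)%nat /\ (j < n)%nat /\ (m <= cdist n i j <= n - m)%nat.

Lemma circ_adj_sym (n m i j : nat) : (0 < m)%nat -> circ_adj n m i j -> circ_adj n m j i.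
Proof. intros Hm (Hi & Hj & H); unfold circ_adj; cdist_cases; lia. Qed.

Lemma circ_adj_arc_disjoint (n m i j c : nat) :
  (c < n)%nat -> circ_adj n m i j -> arc n m i c -> arc n m j c -> False.
Proof. intros Hc (Hi & Hj & H); unfold arc; cdist_cases; lia. Qed.

Lemma cnt_arc_centers (n m c : nat) :
  (m <= n)%nat -> (c < n)%nat -> cnt (fun g => arc n m g c) n = INR m.
Proof.
  (* The arcs through [c] start at the [m] cyclically consecutive positions ending in [c]. They form
     one interval, or two if they wrap around 0. *)
  intros Hm Hc; destruct (le_lt_dec m (c + 1)) as [h|h].
  - transitivity (INR (((c + 1) - (c + 1 - m)))); [|f_equal; lia].
    rewrite <- (cnt_interval _ _ n) by lia; apply lsum_ext; intros g Hg.
    apply in_seq in Hg; apply indic_iff; unfold arc; cdist_cases; lia.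
  - transitivity (INR (((c + 1 - 0) + (n - (c + n + 1 - m))))); [|f_equal; lia].
    rewrite plus_INR, <- !(cnt_interval _ _ n) by lia.
    unfold cnt; rewrite <- lsum_plus; apply lsum_ext; intros g Hg; apply in_seq in Hg.
    destruct (le_lt_dec (c + n + 1 - m) g) as [h1|h1]; [|destruct (le_lt_dec g c) as [h2|h2]].
    + rewrite indic_true, indic_false, indic_true; [lra| | |unfold arc; cdist_cases]; lia.
    + rewrite indic_true, indic_true, indic_false; [lra| | |unfold arc; cdist_cases]; lia.
    + rewrite !indic_false; [lra| | |unfold arc; cdist_cases]; lia.
Qed.

Lemma cnt_arc (n m g : nat) :
  (m <= n)%nat -> (g < n)%nat -> cnt (arc n m g) n = INR m.
Proof.
  intros Hm Hg; destruct (le_lt_dec (g + m) n) as [h|h].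
  - transitivity (INR (((g + m) - g))); [|f_equal; lia].
    rewrite <- (cnt_interval _ _ n) by lia; apply lsum_ext; intros c Hc.
    apply in_seq in Hc; apply indic_iff; unfold arc; cdist_cases; lia.
  - transitivity (INR (((n - g) + (g + m - n - 0)))); [|f_equal; lia].
    rewrite plus_INR, <- !(cnt_interval _ _ n) by lia.
    unfold cnt; rewrite <- lsum_plus; apply lsum_ext; intros c Hc; apply in_seq in Hc.
    destruct (le_lt_dec g c) as [h1|h1]; [|destruct (le_lt_dec (g + m - n) c) as [h2|h2]].
    + rewrite indic_true, indic_true, indic_false; [lra| | |unfold arc; cdist_cases]; lia.
    + rewrite !indic_false; [lra| | |unfold arc; cdist_cases]; lia.
    + rewrite indic_true, indic_false, indic_true; [lra| | |unfold arc; cdist_cases]; lia.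
Qed.

(* Katona's argument: given [i0] in [J], any other element of [J] lies at cyclic distance [t] or
   [t + n - m] from [i0] with [t < m], and for each [t] these two positions are adjacent. *)
Lemma circ_independent_le (n m : nat) (J : nat -> Prop) :
  (0 < m)%nat -> (2 * m <= n)%nat ->
  (forall i j, J i -> J j -> ~ circ_adj n m i j) -> cnt J n <= INR m.
Proof.
  intros Hm Hn HJ; destruct (classic (exists i0, (i0 < n)%nat /\ J i0)) as [[i0 [Hi0 Ji0]]|Hno].
  2:{ unfold cnt; rewrite (lsum_ext _ _ (fun _ => 0)).
      - rewrite lsum_const; pose proof (pos_INR m); lra.
      - intros i Hi; apply in_seq in Hi; apply indic_false; intros h; apply Hno; exists i.
        split; [lia|exact h]. }
  unfold cnt; rewrite cnt_filter; apply le_INR.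
  set (l := filter _ _).
  assert (Hl : forall i, In i l -> (i < n)%nat /\ J i).
  { intros i Hi; apply filter_In in Hi; destruct Hi as [Hi Hb]; apply in_seq in Hi.
    destruct (excluded_middle_informative (J i)); [split; [lia|assumption]|discriminate]. }
  set (phi i := let t := cdist n i0 i in if (m <=? t)%nat then (t - (n - m))%nat else t).
  assert (Hphi : forall i, In i l -> (phi i < m)%nat).
  { intros i Hi; destruct (Hl i Hi) as [Hin Ji]; pose proof (HJ i0 i Ji0 Ji) as Hna.
    unfold circ_adj in Hna; unfold phi; cbv zeta; cdist_cases; lia. }
  rewrite <- (length_map phi l), <- (length_seq m 0).
  apply NoDup_incl_length.
  - apply NoDup_map_NoDup_ForallPairs; [|apply NoDup_filter, seq_NoDup].
    intros i j Hi Hj Heq; destruct (Hl i Hi) as [Hin Ji], (Hl j Hj) as [Hjn Jj].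
    pose proof (HJ i j Ji Jj) as H1; pose proof (HJ j i Jj Ji) as H2.
    pose proof (HJ i0 i Ji0 Ji) as H3; pose proof (HJ i0 j Ji0 Jj) as H4.
    unfold circ_adj in *; unfold phi in Heq; cbv zeta in Heq; cdist_cases; lia.
  - intros t Ht; apply in_map_iff in Ht; destruct Ht as (i & <- & Hi).
    apply in_seq; specialize (Hphi i Hi); lia.
Qed.

(* Exchanging the part of an arc [arc n m g] inside the closed neighbourhood of [I] for [I] keeps
   it independent, so that part has at least as many elements as [I]; average over [g]. *)
Lemma circ_expansion (n m : nat) (I : nat -> Prop) :
  (0 < m)%nat -> (2 * m <= n)%nat -> (forall i j, I i -> I j -> ~ circ_adj n m i j) ->
  INR n * cnt I n <=
  INR m * (cnt I n + cnt (fun t => exists u, I u /\ circ_adj n m t u) n).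
Proof.
  intros Hm Hn HI; set (NI t := exists u, I u /\ circ_adj n m t u).
  assert (Hdis : forall t, I t -> ~ NI t) by (intros t Ht (u & Hu & h); now apply (HI t u)).
  assert (Hg : forall g, (g < n)%nat ->
    cnt I n <= cnt (fun c => (I c \/ NI c) /\ arc n m g c) n).
  { intros g Hg; set (J c := I c \/ (arc n m g c /\ (c < n)%nat /\ ~ NI c)).
    assert (HJ : cnt J n <= INR m).
    { apply circ_independent_le; [exact Hm|exact Hn|].
      intros i j [Hi|(Hi & Hin & Hi')] [Hj|(Hj & Hjn & Hj')] Hadj.
      - now apply (HI i j).
      - apply Hj'; exists i; split; [exact Hi|now apply circ_adj_sym].
      - apply Hi'; now exists j.
      - destruct Hadj as (_ & _ & Hadj); unfold arc in *; cdist_cases; lia. }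
    (* Holds pointwise, because [I] and [NI] are disjoint. Since [cnt J n] is at most [m], the size
       of the arc, the inequality for [g] follows. *)
    assert (Hsum : cnt J n + cnt (fun c => (I c \/ NI c) /\ arc n m g c) n =
                   cnt I n + cnt (arc n m g) n).
    { unfold cnt; rewrite <- !lsum_plus; apply lsum_ext; intros c Hc; apply in_seq in Hc.
      assert (Hcn : (c < n)%nat) by lia; specialize (Hdis c); unfold J.
      destruct (classic (I c)), (classic (NI c)), (classic (arc n m g c));
        repeat first [rewrite (indic_true (I c)) by tauto | rewrite (indic_false (I c)) by tauto
          | rewrite (indic_true (arc n m g c)) by tauto | rewrite (indic_false (arc n m g c)) by tauto
          | rewrite (indic_true (_ \/ _)) by tauto | rewrite (indic_false (_ \/ _)) by tauto
          | rewrite (indic_true (_ /\ _)) by tauto | rewrite (indic_false (_ /\ _)) by tauto];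
        try tauto; lra. }
    rewrite cnt_arc in Hsum by lia; lra. }
  apply Rle_trans with (lsum (fun g => cnt (fun c => (I c \/ NI c) /\ arc n m g c) n) (seq 0 n)).
  - apply Rle_trans with (lsum (fun _ => cnt I n) (seq 0 n)).
    + rewrite lsum_const, length_seq; lra.
    + apply lsum_le; intros g Hgn; apply in_seq in Hgn; apply Hg; lia.
  (* Double counting: every [c] lies in exactly [m] of the [n] arcs. *)
  - apply Req_le; unfold cnt; rewrite lsum_exchange, <- lsum_plus, <- lsum_scal.
    apply lsum_ext; intros c Hc; apply in_seq in Hc.
    rewrite <- (cnt_arc_centers n m c) by lia; unfold cnt; rewrite Rmult_comm, <- lsum_scal.
    apply lsum_ext; intros g _; specialize (Hdis c).
    destruct (classic (arc n m g c)) as [h|h];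
      [rewrite (indic_true _ h)|rewrite (indic_false _ h), indic_false by tauto; lra].
    destruct (classic (I c)) as [h1|h1];
      [rewrite (indic_true _ h1), (indic_false (NI c)), indic_true by tauto; lra|].
    destruct (classic (NI c)) as [h2|h2].
    + rewrite (indic_false _ h1), (indic_true _ h2), indic_true by tauto; lra.
    + rewrite (indic_false _ h1), (indic_false _ h2), indic_false by tauto; lra.
Qed.

(** * Unions of cells of the color interval *)

Definition cells (m : nat) (P : nat -> Prop) (n : nat) (x : R) : Prop :=
  exists c, (c < n)%nat /\ P c /\ Ico (INR c / INR m) (INR (S c) / INR m) x.

Lemma INR_div_le (m a b : nat) : (0 < m)%nat -> (a <= b)%nat -> INR a / INR m <= INR b / INR m.
Proof.
  intros Hm Hab; apply Rmult_le_compat_r; [|now apply le_INR].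
  apply Rlt_le, Rinv_0_lt_compat, lt_0_INR, Hm.
Qed.

Lemma cell_unique (m c c' : nat) (x : R) :
  (0 < m)%nat -> Ico (INR c / INR m) (INR (S c) / INR m) x ->
  Ico (INR c' / INR m) (INR (S c') / INR m) x -> c = c'.
Proof.
  unfold Ico; intros Hm H H'; destruct (Nat.lt_trichotomy c c') as [h|[h|h]]; [|exact h|].
  - pose proof (INR_div_le m (S c) c' Hm h); lra.
  - pose proof (INR_div_le m (S c') c Hm h); lra.
Qed.

Lemma cell_exists (m n : nat) (x : R) :
  Ico 0 (INR n / INR m) x ->
  exists c, (c < n)%nat /\ Ico (INR c / INR m) (INR (S c) / INR m) x.
Proof.
  induction n as [|n IH]; intros Hx.
  - unfold Ico in Hx; simpl in Hx; lra.
  - destruct (Rlt_dec x (INR n / INR m)) as [h|h].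
    + destruct IH as (c & Hc & Hcx); [unfold Ico in *; lra|exists c; split; [lia|exact Hcx]].
    + exists n; split; [lia|unfold Ico in *; lra].
Qed.

Lemma cells_in_cell (m n c : nat) (P : nat -> Prop) (x : R) :
  (0 < m)%nat -> (c < n)%nat -> Ico (INR c / INR m) (INR (S c) / INR m) x ->
  (cells m P n x <-> P c).
Proof.
  intros Hm Hc Hx; split.
  - intros (c' & _ & HP & Hx'); now rewrite (cell_unique m c c' x).
  - intros HP; now exists c.
Qed.

Lemma cells_spec (m n : nat) (P : nat -> Prop) :
  (0 < m)%nat ->
  subset (cells m P n) (Ico 0 (INR n / INR m)) /\ lmeasurable (cells m P n) /\
  mu (cells m P n) = cnt P n / INR m.
Proof.
  intros Hm; assert (Hm' : 0 < INR m) by now apply lt_0_INR.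
  assert (Hsub : forall n, subset (cells m P n) (Ico 0 (INR n / INR m))).
  { clear n; intros n x (c & Hc & _ & Hx); unfold Ico in *.
    pose proof (INR_div_le m (S c) n Hm Hc); pose proof (INR_div_le m 0 c Hm ltac:(lia)) as h.
    unfold Rdiv at 1 in h; simpl INR in h at 1; lra. }
  split; [apply Hsub|]; induction n as [|n [IHm IHe]].
  - split.
    + apply lmeasurable_ext with (fun _ => False); [|apply lmeasurable_empty].
      intros x; split; [tauto|intros (c & Hc & _); lia].
    + rewrite mu_empty; [unfold cnt; simpl; lra|intros x (c & Hc & _); lia].
  - set (C x := P n /\ Ico (INR n / INR m) (INR (S n) / INR m) x).
    assert (Hiff : forall x, cup (cells m P n) C x <-> cells m P (S n) x).
    { intros x; split.
      - intros [(c & Hc & h)|h]; [exists c|exists n]; split; auto; lia.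
      - intros (c & Hc & h); destruct (Nat.eq_dec c n) as [->|Hne]; [now right|].
        left; exists c; split; [lia|exact h]. }
    assert (HC : lmeasurable C /\ finite_outer C /\ mu C = indic (P n) / INR m).
    { destruct (classic (P n)) as [h|h].
      - rewrite (indic_true _ h); split; [|split].
        + apply lmeasurable_ext with (Ico (INR n / INR m) (INR (S n) / INR m));
            [unfold C; tauto|apply lmeasurable_Ico].
        + apply (finite_in_Ico (INR n / INR m) (INR (S n) / INR m)); now intros x [_ Hx].
        + rewrite (mu_ext C (Ico (INR n / INR m) (INR (S n) / INR m))) by (unfold C; tauto).
          rewrite mu_Ico by (apply INR_div_le; [exact Hm|lia]); rewrite S_INR; field; lra.
      - rewrite (indic_false _ h); split; [|split].
        + apply lmeasurable_ext with (fun _ => False); [unfold C; tauto|apply lmeasurable_empty].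
        + apply (finite_in_Ico 0 0); intros x [h' _]; tauto.
        + rewrite mu_empty; [lra|unfold C; tauto]. }
    destruct HC as (mC & fC & eC); split.
    + apply lmeasurable_ext with (cup (cells m P n) C); [exact Hiff|].
      now apply lmeasurable_cup.
    + rewrite <- (mu_ext _ _ Hiff), mu_add, IHe, eC, cnt_S; auto; [lra| |].
      * now apply (finite_in_Ico _ _ _ (Hsub n)).
      * intros x [Hx [_ Hx']]; apply Hsub in Hx; unfold Ico in *; lra.
Qed.

Lemma arc_cells_unit (n m i : nat) :
  (0 < m)%nat -> (m <= n)%nat -> (i < n)%nat ->
  unit_color_set (INR n / INR m) (cells m (arc n m i) n).
Proof.
  intros Hm Hmn Hi; apply unit_color_set_iff.
  destruct (cells_spec m n (arc n m i) Hm) as (h1 & h2 & h3).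
  split; [exact h1|split; [exact h2|]]; rewrite h3, cnt_arc by assumption.
  field; apply not_0_INR; lia.
Qed.

(* The vertices [n + t * N + j] ([t < n], [j < N]) are twins of the vertex [t] of the circular
   graph, and each [n + n * N + (t * N + j)] is a pendant vertex attached to such a twin. *)
Definition twin_edge (n m N u v : nat) : Prop :=
  circ_adj n m u v \/
  ((n <= u < n + n * N)%nat /\ circ_adj n m ((u - n) / N) v) \/
  ((n <= u < n + n * N)%nat /\ v = (u + n * N)%nat).

Lemma twin_edge_range (n m N u v : nat) :
  twin_edge n m N u v -> (u < n + 2 * (n * N))%nat /\ (v < n + 2 * (n * N))%nat.
Proof. intros [h|[[h h']|h]]; unfold circ_adj in *; lia. Qed.

Lemma twin_edge_irrefl (n m N u : nat) : (0 < m)%nat -> ~ twin_edge n m N u u.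
Proof.
  intros Hm [(_ & _ & h)|[[h (_ & h' & _)]|h]]; [cdist_cases; lia|lia|lia].
Qed.

Definition twin_graph (n m N : nat) (Hm : (0 < m)%nat) : graph.
Proof.
  refine (Graph (n + 2 * (n * N)) (fun u v => twin_edge n m N u v \/ twin_edge n m N v u) _ _ _).
  - intros u v [h|h]; [now right|now left].
  - intros u [h|h]; now apply (twin_edge_irrefl n m N u Hm).
  - intros u v [h|h]; apply twin_edge_range in h; tauto.
Defined.

(** A homomorphism to the circular clique: a core vertex goes to itself, a twin of [t] to [t], and a
    pendant vertex at a twin of [t] to the neighbour [t + m] of [t] modulo [n]. *)
Definition label (n m N u : nat) : nat :=
  if (n <=? u)%nat then
    if (n + n * N <=? u)%nat then
      let t := ((u - n - n * N) / N)%nat in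
      if (n <=? t + m)%nat then (t + m - n)%nat else (t + m)%nat
    else ((u - n) / N)%nat
  else u.

Lemma twin_edge_label (n m N u v : nat) :
  (0 < m)%nat -> (2 * m <= n)%nat -> twin_edge n m N u v ->
  circ_adj n m (label n m N u) (label n m N v).
Proof.
  intros Hm Hn; unfold label; intros [h|[[h h']|[h ->]]].
  - assert ((u < n)%nat /\ (v < n)%nat) as [hu hv] by (unfold circ_adj in h; lia).
    destruct (Nat.leb_spec n u), (Nat.leb_spec n v); lia || exact h.
  - assert (hv : (v < n)%nat) by (unfold circ_adj in h'; lia).
    destruct (Nat.leb_spec n u), (Nat.leb_spec (n + n * N) u), (Nat.leb_spec n v);
      lia || exact h'.
  - replace (u + n * N - n - n * N)%nat with (u - n)%nat by lia.
    assert (ht : ((u - n) / N < n)%nat) by (apply Nat.Div0.div_lt_upper_bound; lia).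
    destruct (Nat.leb_spec n u), (Nat.leb_spec (n + n * N) u),
      (Nat.leb_spec n (u + n * N)), (Nat.leb_spec (n + n * N) (u + n * N)); try lia.
    cbv zeta; unfold circ_adj; cdist_cases; lia.
Qed.

Lemma label_lt (n m N u : nat) :
  (0 < m)%nat -> (2 * m <= n)%nat -> (u < n + 2 * (n * N))%nat -> (label n m N u < n)%nat.
Proof.
  intros Hm Hn Hu; unfold label.
  destruct (Nat.leb_spec n u), (Nat.leb_spec (n + n * N) u); try lia.
  - assert (ht : ((u - n - n * N) / N < n)%nat) by (apply Nat.Div0.div_lt_upper_bound; lia).
    cbv zeta; destruct (Nat.leb_spec n ((u - n - n * N) / N + m)); lia.
  - apply Nat.Div0.div_lt_upper_bound; lia.
Qed.

(** The coloring of the circular clique by arcs of [m] cells is pulled back along [label]. *)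
Lemma twin_graph_colorable (n m N : nat) (Hm : (0 < m)%nat) :
  (2 * m <= n)%nat -> frac_colorable (twin_graph n m N Hm) (INR n / INR m).
Proof.
  intros Hn; exists (fun u => cells m (arc n m (label n m N u)) n); split.
  - intros v Hv; apply arc_cells_unit; [exact Hm|lia|now apply label_lt].
  - intros u v Huv x [(c & Hc & Hcu & Hx) (c' & Hc' & Hcv & Hx')].
    rewrite <- (cell_unique m c c' x Hm Hx Hx') in Hcv.
    destruct Huv as [h|h]; apply twin_edge_label in h; try assumption.
    + now apply (circ_adj_arc_disjoint n m _ _ c Hc h).
    + now apply (circ_adj_arc_disjoint n m _ _ c Hc h).
Qed.

Lemma pendant_neighbor (n m N : nat) (Hm : (0 < m)%nat) (w v : nat) :
  (n + n * N <= w)%nat -> adj (twin_graph n m N Hm) w v -> (v + n * N = w)%nat.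
Proof. intros Hw [h|h]; unfold twin_edge, circ_adj in h; lia. Qed.

(** A walk between different pendant vertices passes through their twins. These are distinct and
    nonadjacent, since a twin is joined only to core vertices and to its pendant vertex. *)
Lemma twin_graph_far_apart (n m N : nat) (Hm : (0 < m)%nat) :
  far_apart (twin_graph n m N Hm) (fun u => (n + n * N <= u < n + 2 * (n * N))%nat) 4.
Proof.
  split; [intros w Hw; simpl; lia|]; intros u v Hu Hv Huv l Hl.
  destruct Hl as [u|u a v l h1 Hl]; [lia|].
  pose proof (pendant_neighbor _ _ _ _ _ _ (proj1 Hu) h1) as e1.
  destruct Hl as [a|a b v l h2 Hl]; [lia|].
  destruct Hl as [b|b c v l h3 Hl].
  - apply adj_sym, (pendant_neighbor _ _ _ _ _ _ (proj1 Hv)) in h2; lia.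
  - destruct Hl as [c|c d v l h4 Hl]; [|lia].
    apply adj_sym, (pendant_neighbor _ _ _ _ _ _ (proj1 Hv)) in h3.
    destruct h2 as [h|h]; unfold twin_edge, circ_adj in h; lia.
Qed.

(** * The averaging argument *)

(** With [K = N / m], [k = n / m] and [e = K - k], the conclusion is [1 <= e * (e + k - 1)]. *)
Lemma large_eps_of_extends (n m N : nat) :
  (0 < m)%nat -> (2 * m <= n)%nat -> (n <= N)%nat ->
  (forall (G : graph) (W : nat -> Prop) (p : nat -> R -> Prop),
    frac_colorable G (INR n / INR m) -> far_apart G W 4 ->
    frac_precoloring (INR N / INR m) W p -> extends G (INR N / INR m) W p) ->
  1 <= (INR N / INR m - INR n / INR m) * (INR N / INR m - 1).
Proof.
  intros Hm Hn HN Hext.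
  set (G := twin_graph n m N Hm).
  (* The pendant vertex with index [t * N + j] receives the arc starting at [j], so for each [t] all
     [N] arcs occur. *)
  set (p u := cells m (arc N m ((u - n - n * N) mod N)) N).
  destruct (Hext G _ p (twin_graph_colorable n m N Hm Hn) (twin_graph_far_apart n m N Hm))
    as (c & [Hc Hdis] & Hcp).
  { intros w _; apply arc_cells_unit; [exact Hm|lia|apply Nat.mod_upper_bound; lia]. }
  clear Hext; set (K := INR N / INR m) in *; set (k := INR n / INR m).
  assert (Hm' : 0 < INR m) by now apply lt_0_INR.
  assert (Hn' : 0 < INR n) by (apply lt_0_INR; lia).
  assert (HmN : INR m < INR N) by (apply lt_INR; lia).
  assert (HK : 0 <= K).
  { apply Rmult_le_pos; [lra|apply Rlt_le, Rinv_0_lt_compat; lra]. }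
  assert (HnvG : nv G = (n + 2 * (n * N))%nat) by reflexivity.
  assert (Hcore : forall u, (u < n)%nat -> unit_color_set K (c u)).
  { intros u Hu; apply Hc; rewrite HnvG; lia. }
  set (used t x := exists u, In u (seq 0 n) /\ (circ_adj n m t u /\ c u x)).
  set (A t := dif (Ico 0 K) (used t)).
  assert (mA : forall t, lmeasurable (A t)).
  { intros t; apply lmeasurable_dif; [apply lmeasurable_Ico|].
    apply lmeasurable_exists_list; intros u Hu; apply in_seq in Hu.
    destruct (classic (circ_adj n m t u)) as [h|h].
    - apply lmeasurable_ext with (c u); [tauto|apply (Hcore u); lia].
    - apply lmeasurable_ext with (fun _ => False); [tauto|apply lmeasurable_empty]. }
  assert (sA : forall t, subset (A t) (Ico 0 K)) by now intros t x [].
  assert (fA : forall t, finite_outer (A t)) by (intros t; exact (finite_in_Ico _ _ _ (sA t))).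
  set (q j := cells m (arc N m j) N).
  assert (mq : forall j, lmeasurable (q j)) by (intros j; apply (cells_spec m N _ Hm)).
  (* The twin of [t] with index [j] has the core neighbours of [t] and a pendant neighbour colored
     [q j], so its color set fits into [A t] minus [q j]. *)
  assert (Hj : forall t j, (t < n)%nat -> (j < N)%nat -> 1 <= mu (A t) - mu (cap (A t) (q j))).
  { intros t j Ht Hj.
    assert (Htj : (t * N + j < n * N)%nat) by nia.
    assert (Hdiv : ((t * N + j) / N = t)%nat) by (symmetry; apply (Nat.div_unique _ _ _ j); lia).
    assert (Hmod : ((t * N + j) mod N = j)%nat)
      by (symmetry; apply (Nat.mod_unique _ _ t); lia).
    set (v := (n + (t * N + j))%nat); set (w := (v + n * N)%nat).
    assert (Hvn : unit_color_set K (c v)) by (apply Hc; rewrite HnvG; unfold v; lia).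
    apply unit_color_set_iff in Hvn; destruct Hvn as (sv & _ & ev).
    rewrite (mu_split (q j) (A t) (mq j) (fA t)), <- ev.
    assert (mu (c v) <= mu (dif (A t) (q j))); [|lra].
    apply mu_mono; [|now apply finite_dif].
    intros x Hx; split; [split; [now apply sv|]|].
    - intros (u & Hu & Hadj & Hux); apply (Hdis v u) with x; [|now split].
      left; right; left; split; [unfold v; lia|].
      unfold v; rewrite Nat.add_comm, Nat.add_sub, Hdiv; exact Hadj.
    - intros Hqx; apply (Hdis v w) with x.
      + left; right; right; split; [unfold v; lia|reflexivity].
      + split; [exact Hx|]; apply Hcp; [unfold w, v; lia|].
        unfold p, w, v; replace (n + (t * N + j) + n * N - n - n * N)%nat with (t * N + j)%nat by lia.
        rewrite Hmod; exact Hqx. }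
  (* Summing [Hj] over [j], where each color of [A t] lies in [m] of the [N] arcs, gives
     [mu (A t) * (1 - 1 / K) >= 1] multiplied by [N]. *)
  assert (HAt : forall t, (t < n)%nat -> INR N <= (INR N - INR m) * mu (A t)).
  { intros t Ht.
    assert (He : lsum (fun j => 1 * mu (cap (A t) (q j))) (seq 0 N) = INR m * mu (A t)).
    { apply lsum_mu_eq; auto; intros x Hx.
      destruct (cell_exists m N x (sA t x Hx)) as (b & Hb & Hbx).
      rewrite <- (cnt_arc_centers N m b) by lia; apply lsum_ext; intros j _.
      rewrite Rmult_1_l; apply indic_iff; now apply cells_in_cell. }
    assert (Hs : lsum (fun _ => 1) (seq 0 N) <=
                 lsum (fun j => mu (A t) + -1 * (1 * mu (cap (A t) (q j)))) (seq 0 N)).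
    { apply lsum_le; intros j Hjn; apply in_seq in Hjn.
      specialize (Hj t j Ht ltac:(lia)); lra. }
    rewrite lsum_plus, lsum_scal, He, !lsum_const, length_seq in Hs; lra. }
  (* For a color [x] with core class [I], the first sum is [n] minus the size of the neighbourhood
     of [I], and that size is at least [(k - 1) * cnt I n] by [circ_expansion]. *)
  assert (Hpt : forall x, Ico 0 K x ->
    lsum (fun t => 1 * indic (A t x)) (seq 0 n) +
    lsum (fun u => (k - 1) * indic (c u x)) (seq 0 n) <= INR n).
  { intros x Hx; set (I u := (u < n)%nat /\ c u x).
    assert (HI : INR n * cnt I n <=
      INR m * (cnt I n + cnt (fun t => exists u, I u /\ circ_adj n m t u) n)).
    { apply circ_expansion; [exact Hm|exact Hn|].
      intros i j [_ Hi] [_ Hj'] Hadj; apply (Hdis i j) with x; [|now split].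
      now left; left. }
    rewrite (lsum_scal _ (k - 1)), (lsum_ext _ (fun u => indic (c u x)) (fun u => indic (I u)));
      [|intros u Hu; apply in_seq in Hu; apply indic_iff; unfold I; intuition lia].
    fold (cnt I n).
    assert (Ha : lsum (fun t => 1 * indic (A t x)) (seq 0 n) +
                 cnt (fun t => exists u, I u /\ circ_adj n m t u) n = INR n).
    { unfold cnt; rewrite <- lsum_plus, (lsum_ext _ _ (fun _ => 1)).
      - rewrite lsum_const, length_seq; lra.
      - intros t _; destruct (classic (exists u, I u /\ circ_adj n m t u)) as [h|h].
        + rewrite indic_false, indic_true; [lra|exact h|].
          intros [_ h']; apply h'; destruct h as (u & [Hu Hux] & Hadj).
          exists u; split; [apply in_seq; lia|now split].
        + rewrite indic_true, indic_false; [lra|exact h|].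
          split; [exact Hx|]; intros (u & Hu & Hadj & Hux); apply in_seq in Hu.
          apply h; exists u; split; [split; [lia|exact Hux]|exact Hadj]. }
    assert (Hk : (k - 1) * cnt I n <= cnt (fun t => exists u, I u /\ circ_adj n m t u) n).
    { apply Rmult_le_reg_l with (INR m); [exact Hm'|].
      replace (INR m * ((k - 1) * cnt I n)) with (INR n * cnt I n - INR m * cnt I n)
        by (unfold k; field; lra).
      lra. }
    lra. }
  (* [Hpt] is integrated over [Ico 0 K], each [c u] having measure one. The sum type joins the two
     families into the single list expected by [lsum_mu_le]. *)
  assert (Hint : lsum (fun t => mu (A t)) (seq 0 n) + (k - 1) * INR n <= INR n * K).
  { pose proof (lsum_mu_le (nat + nat) (map inl (seq 0 n) ++ map inr (seq 0 n))
      (fun s => match s with inl _ => 1 | inr _ => k - 1 end)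
      (fun s => match s with inl t => A t | inr u => c u end)) as H.
    specialize (H ltac:(intros s Hs; apply in_app_or in Hs; destruct Hs as [Hs|Hs];
      apply in_map_iff in Hs; destruct Hs as (i & <- & Hi);
      [apply mA|apply in_seq in Hi; apply (Hcore i); lia])).
    specialize (H (Ico 0 K) (INR n) (finite_Ico 0 K)
      ltac:(intros x Hx; rewrite lsum_app, !lsum_map; exact (Hpt x Hx))).
    rewrite lsum_app, !lsum_map, mu_Ico, Rminus_0_r in H by exact HK.
    rewrite lsum_scal with (f := fun u => mu (cap (Ico 0 K) (c u))) in H.
    rewrite (lsum_ext _ (fun u => mu (cap (Ico 0 K) (c u))) (fun _ => 1)) in H.
    - rewrite lsum_const, length_seq in H.
      rewrite (lsum_ext _ _ (fun t => mu (A t))) in H; [lra|].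
      intros t _; rewrite Rmult_1_l; apply mu_ext; intros x.
      specialize (sA t x); unfold cap; tauto.
    - intros u Hu; apply in_seq in Hu.
      assert (Huu : unit_color_set K (c u)) by (apply Hcore; lia).
      apply unit_color_set_iff in Huu; destruct Huu as (s & _ & <-).
      apply mu_ext; intros x; specialize (s x); unfold cap; tauto. }
  assert (Hsum : lsum (fun _ => INR N) (seq 0 n) <=
                 lsum (fun t => (INR N - INR m) * mu (A t)) (seq 0 n)).
  { apply lsum_le; intros t Ht; apply in_seq in Ht; apply HAt; lia. }
  rewrite lsum_const, lsum_scal, length_seq in Hsum.
  (* Dividing by [n] and [m] leaves [K <= (K - 1) * (K - k + 1)], which is the claim after
     subtracting [K - 1]. *)
  assert (Hfin : INR n * INR N <= INR n * ((INR N - INR m) * (K - k + 1))).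
  { eapply Rle_trans; [exact Hsum|].
    replace (INR n * ((INR N - INR m) * (K - k + 1))) with
      ((INR N - INR m) * (INR n * K - (k - 1) * INR n)) by ring.
    apply Rmult_le_compat_l; lra. }
  apply Rmult_le_reg_l in Hfin; [|exact Hn'].
  apply Rmult_le_reg_l with (INR m); [exact Hm'|].
  replace (INR N) with (K * INR m) in Hfin by (unfold K; field; lra).
  nra.
Qed.

(** * Rational approximation and conclusion *)

(** The number [y] need not be rational, whereas the averaging argument needs [k] and [k + e] to be
    multiples of a common [1 / m]. Goodness of [y] passes to every larger value, so [y] may be
    replaced by a nearby multiple [e] of [1 / m]. *)
Lemma good_eps_lower_bound (q : Q) (y : R) :
  2 <= Q2R q -> good_eps (Q2R q) 4 y ->
  forall x, y < x -> exists e, y <= e < x /\ 1 <= e * (e + Q2R q - 1).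
Proof.
  intros Hq [Hy Hgood] x Hyx; destruct q as [a b].
  set (k := Q2R (a # b)) in *.
  assert (Hb : 0 < INR (Pos.to_nat b)) by apply pos_INR_nat_of_P.
  assert (Ha : k * INR (Pos.to_nat b) = IZR a).
  { unfold k, Q2R; simpl; rewrite INR_IZR_INZ, positive_nat_Z; field.
    apply not_0_IZR; lia. }
  assert (Ha0 : (0 <= a)%Z) by (apply le_IZR; rewrite <- Ha; nra).
  set (a' := Z.to_nat a).
  assert (Ha' : INR a' = IZR a) by (unfold a'; rewrite INR_IZR_INZ, Z2Nat.id by exact Ha0; easy).
  (* Multiplying the denominator of [k] by [t] makes the grid finer than [x - y]; rounding [y] up to
     the grid then stays below [x]. *)
  assert (Ht : exists t, (0 < t)%nat /\ 1 < (x - y) * (INR (Pos.to_nat b) * INR t)).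
  { destruct (archimed_cor1 ((x - y) * INR (Pos.to_nat b))) as [t [Ht Htp]]; [nra|].
    exists t; split; [exact Htp|]; apply lt_0_INR in Htp.
    apply Rmult_lt_compat_r with (r := INR t) in Ht; [|exact Htp].
    rewrite Rinv_l in Ht by lra; lra. }
  destruct Ht as (t & Htp & Ht).
  set (m := (Pos.to_nat b * t)%nat); set (n := (a' * t)%nat).
  assert (Htp' : 0 < INR t) by now apply lt_0_INR.
  assert (Hm : 0 < INR m) by (unfold m; rewrite mult_INR; nra).
  assert (Hnk : INR n = k * INR m).
  { unfold n, m; rewrite !mult_INR, Ha', <- Ha; ring. }
  assert (Hmx : 1 < (x - y) * INR m) by (unfold m; rewrite mult_INR; exact Ht).
  destruct (archimed (y * INR m)) as [Hu1 Hu2].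
  assert (Hup : (0 <= up (y * INR m))%Z).
  { apply le_IZR; apply Rle_trans with (y * INR m); [|lra]; apply Rmult_le_pos; lra. }
  set (s := Z.to_nat (up (y * INR m))).
  assert (Hs : INR s = IZR (up (y * INR m))).
  { unfold s; rewrite INR_IZR_INZ, Z2Nat.id by exact Hup; easy. }
  assert (Hkm : INR n / INR m = k) by (rewrite Hnk; field; lra).
  set (e := INR s / INR m).
  assert (HKe : INR (n + s) / INR m = k + e).
  { unfold e; rewrite plus_INR, Hnk; field; lra. }
  assert (He : e * INR m = INR s) by (unfold e; field; lra).
  assert (Hye : y <= e) by (apply Rmult_le_reg_r with (INR m); lra).
  exists e; split; [split; [exact Hye|apply Rmult_lt_reg_r with (INR m); lra]|].
  replace (e * (e + k - 1)) with
    ((INR (n + s) / INR m - INR n / INR m) * (INR (n + s) / INR m - 1))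
    by (rewrite HKe, Hkm; ring).
  apply large_eps_of_extends.
  - apply INR_lt; exact Hm.
  - apply INR_le; rewrite mult_INR, Hnk; simpl INR; nra.
  - lia.
  - rewrite HKe, Hkm; intros G W p; now apply Hgood.
Qed.

Theorem mainTheorem1 : forall q : Q,
  2 <= Q2R q < 3 ->
  g_is (Q2R q) 4 ((sqrt ((Q2R q - 1) ^ 2 + 4) - Q2R q + 1) / 2).
Proof.
  intros q Hq; set (k := Q2R q) in *.
  set (r := sqrt ((k - 1) ^ 2 + 4)); set (x := (r - k + 1) / 2).
  assert (Hr : r * r = (k - 1) ^ 2 + 4) by (apply sqrt_sqrt; nra).
  assert (Hr0 : 0 <= r) by apply sqrt_pos.
  assert (Hx : 0 <= x) by (unfold x; nra).
  assert (Hroot : x * (x + k - 1) = 1) by (unfold x; nra).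
  split.
  (* Since [e * (e + k - 1)] increases for [e >= 0] and equals 1 at [x], no [e < x] can satisfy the
     bound. *)
  - intros y Hy; apply Rnot_lt_le; intros Hyx.
    destruct (good_eps_lower_bound q y (proj1 Hq) Hy x Hyx) as (e & He & He1).
    fold k in He1; destruct Hy as [Hy _]; nra.
  (* The infimum is attained: [x] itself is good. *)
  - intros b Hb; apply Hb; split; [exact Hx|].
    intros e He G W p; apply extends_of_large_eps; [lra|lra|nra].
Qed.
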